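(* Let $\mathbf{H}\in\mathbb{C}^{n\times n}$ be Hermitian and $\mathbf{S}\in\mathbb{C}^{n\times n}$ Hermitian positive definite, with $\|\mathbf{H}\|\le1$, $\|\mathbf{S}^{-1}\|\le1$ and $\|\mathbf{S}^{-1}\mathbf{H}\|\le1$, and let $\epsilon\in(0,1)$. Algorithm $\mathsf{TRANSH}(\mathbf{H},\mathbf{S})$: compute $\mathbf{S}_{\mathsf{INV}}=\mathsf{HERM}(\mathsf{INV}(\mathbf{S}))$, $\mathbf{L}=\mathsf{CHOL}(\mathbf{S}_{\mathsf{INV}})$, and return $\widetilde{\mathbf{H}}=\mathsf{HERM}(\mathsf{MM}(\mathsf{MM}(\mathbf{L}^*,\mathbf{H}),\mathbf{L}))$. There are constants $\rho_1,\rho_2,\rho_3$ such that if the unit roundoff satisfies $$\mathbf{u}\le\epsilon\,\frac{1}{\rho_1n^{\rho_2}\kappa(\mathbf{S})^{\rho_3\log n}},$$ then there exists a matrix $\mathbf{B}$ with $\|\mathbf{S}^{-1}\mathbf{H}-\mathbf{B}\|\le\epsilon\|\mathbf{S}^{-1}\|\|\mathbf{H}\|$ and $\Lambda(\widetilde{\mathbf{H}})=\Lambda(\mathbf{B})$.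
   Context: $\Lambda(\cdot)$ denotes the spectrum, $\kappa(\mathbf{X})=\|\mathbf{X}\|\|\mathbf{X}^{-1}\|$ in spectral norm. Floating point model with unit roundoff $\mathbf{u}$: $\mathrm{fl}(a\odot b)=(1+\delta)(a\odot b)$, $|\delta|\le\mathbf{u}$. $\mathsf{MM}$: $\|\mathsf{MM}(\mathbf{X},\mathbf{Y})-\mathbf{X}\mathbf{Y}\|\le\mu_{\mathsf{MM}}(n)\mathbf{u}\|\mathbf{X}\|\|\mathbf{Y}\|$, $\mu_{\mathsf{MM}}(n)=n^{c_\eta}$. $\mathsf{INV}$: $\|\mathsf{INV}(\mathbf{X})-\mathbf{X}^{-1}\|\le\mu_{\mathsf{INV}}(n)\mathbf{u}\kappa(\mathbf{X})^{c_{\mathsf{INV}}\log n}\|\mathbf{X}^{-1}\|$, $\mu_{\mathsf{INV}}$ polynomial, $c_{\mathsf{INV}}\le8$. $\mathsf{HERM}(\mathbf{X})$ replaces the strictly lower triangular part of $\mathbf{X}$ by the conjugate transpose of its strictly upper triangular part. $\mathsf{CHOL}(\mathbf{M})$ is the recursive block Cholesky algorithm: for $n=1$ return $\mathrm{fl}(\sqrt{\mathbf{M}_{1,1}})$; otherwise, with $\mathbf{M}=\begin{pmatrix}\mathbf{A}&\mathbf{B}^*\\ \mathbf{B}&\mathbf{C}\end{pmatrix}$, compute $\mathbf{L}_{11}=\mathsf{CHOL}(\mathbf{A})$, $\mathbf{W}=\mathsf{MM}(\mathbf{B},\mathsf{INV}(\mathbf{A}))$, $\mathbf{L}_{21}=\mathsf{MM}(\mathbf{W},\mathbf{L}_{11})$,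 $\widetilde{\mathbf{S}}=\mathrm{fl}(\mathbf{C}-\mathsf{HERM}(\mathsf{MM}(\mathbf{W},\mathbf{B}^* )))$, $\mathbf{L}_{22}=\mathsf{CHOL}(\widetilde{\mathbf{S}})$, and return $\begin{pmatrix}\mathbf{L}_{11}&0\\ \mathbf{L}_{21}&\mathbf{L}_{22}\end{pmatrix}$. *)

(* Defs.v *)
From mathcomp Require Import all_boot all_order all_algebra.
From mathcomp Require Import sesquilinear spectral.
From mathcomp Require Import complex.
From mathcomp Require Import all_classical all_reals all_analysis.

Set Implicit Arguments.
Unset Strict Implicit.
Unset Printing Implicit Defensive.

Import Order.TTheory GRing.Theory Num.Theory.

Local Open Scope classical_set_scope.
Local Open Scope ring_scope.
Local Open Scope complex_scope.
Local Open Scope sesquilinear_scope.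

Section MatrixNotions.
Context {R : realType}.
Local Notation C := R[i].

Definition l2norm n (x : 'cV[C]_n) : R :=
  Num.sqrt (\sum_(i < n) (complex.Re `|x i ord0|) ^+ 2).

(* For n = 0 the set is empty, and its sup is 0. *)
Definition specnorm m n (A : 'M[C]_(m, n)) : R :=
  sup [set l2norm (A *m x) | x in [set x : 'cV[C]_n | l2norm x = 1]].

Definition kappa n (A : 'M[C]_n) : R := specnorm A * specnorm (invmx A).

Definition spectrum n (A : 'M[C]_n) : set C := [set a | eigenvalue A a].

Definition posdefmx n (A : 'M[C]_n) : Prop :=
  A \is hermsymmx /\
  forall x : 'cV[C]_n, x != 0 -> 0 < (x^t* *m A *m x) ord0 ord0.

(* The diagonal is left untouched, so it need not be real. *)
Definition HERM n (X : 'M[C]_n) : 'M[C]_n :=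
  \matrix_(i < n, j < n) (if (i <= j)%N then X i j else Num.conj (X j i)).

Definition log2 (x : R) : R := ln x / ln 2.

Definition poly_bounded (f : nat -> R) : Prop :=
  exists p : {poly R}, forall n : nat, (0 < n)%N -> f n <= p.[n%:R].

End MatrixNotions.

(* [MM] takes rectangular arguments because the two diagonal blocks in [CHOL]
   differ in size when n is odd. *)
Record fparith (R : realType) := FPArith {
  fl_sub : R[i] -> R[i] -> R[i];
  fl_sqrt : R[i] -> R[i];
  MM : forall m n p, 'M[R[i]]_(m, n) -> 'M[R[i]]_(n, p) -> 'M[R[i]]_(m, p);
  INV : forall n, 'M[R[i]]_n -> 'M[R[i]]_n
}.

Definition fl_of (R : realType) (u : R) (exact computed : R[i]) : Prop :=
  exists delta : R[i], `|delta| <= u%:C /\ computed = (1 + delta) * exact.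

(* [sqrtc] is the principal square root on R[i]; it is the usual root on
   nonnegative reals. Its argument in [CHOL] may carry a small imaginary part,
   since [HERM] does not alter diagonal entries. *)
Record fparith_spec (R : realType) (c_eta : R) (mu_INV : nat -> R) (c_INV u : R)
    (F : fparith R) : Prop := FPArithSpec {
  fl_subP : forall a b : R[i], fl_of u (a - b) (fl_sub F a b);
  fl_sqrtP : forall a : R[i], fl_of u (sqrtc a) (fl_sqrt F a);
  MMP : forall m n p (X : 'M[R[i]]_(m, n)) (Y : 'M[R[i]]_(n, p)),
    specnorm (MM F X Y - X *m Y)
      <= (maxn m (maxn n p))%:R `^ c_eta * u * specnorm X * specnorm Y;
  INVP : forall n (X : 'M[R[i]]_n), (0 < n)%N -> X \in unitmx ->
    specnorm (INV F X - invmx X)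
      <= mu_INV n * u * kappa X `^ (c_INV * log2 n%:R) * specnorm (invmx X)
}.

Section Algorithms.
Context {R : realType}.
Local Notation C := R[i].
Variable F : fparith R.

Definition fl_subm m n (X Y : 'M[C]_(m, n)) : 'M[C]_(m, n) :=
  \matrix_(i < m, j < n) fl_sub F (X i j) (Y i j).

Lemma half_split n : (n./2 + uphalf n = n)%N.
Proof. by rewrite uphalf_half addnCA addnn odd_double_half. Qed.

Section CholStep.
Variable chol : forall n, 'M[C]_n -> 'M[C]_n.

Definition CHOL_block n1 n2 (M : 'M[C]_(n1 + n2)) : 'M[C]_(n1 + n2) :=
  let A := ulsubmx M in
  let B := dlsubmx M in
  let D := drsubmx M in
  let L11 := chol A in
  let W := MM F B (INV F A) in
  let L21 := MM F W L11 in
  let St := fl_subm D (HERM (MM F W (B^t*))) in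
  let L22 := chol St in
  block_mx L11 0 L21 L22.

Definition CHOL_step n (M : 'M[C]_n) : 'M[C]_n :=
  if (n <= 1)%N then \matrix_(i < n, j < n) fl_sqrt F (M i j)
  else castmx (half_split n, half_split n)
         (CHOL_block (castmx (esym (half_split n), esym (half_split n)) M)).

End CholStep.

(* [k] is recursion fuel; [CHOL_unfold] shows that n units suffice. *)
Fixpoint CHOL_rec (k : nat) : forall n, 'M[C]_n -> 'M[C]_n :=
  if k is k'.+1 then CHOL_step (CHOL_rec k') else fun n _ => 0.

Definition CHOL n (M : 'M[C]_n) : 'M[C]_n := CHOL_rec n M.

Lemma CHOL_rec_fuel k n (M : 'M[C]_n) : (n <= k)%N -> CHOL_rec k M = CHOL M.
Proof.
rewrite /CHOL; suff H k1 k2 m (N : 'M[C]_m) :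
  (m <= k1)%N -> (m <= k2)%N -> CHOL_rec k1 N = CHOL_rec k2 N by move=> ?; exact: H.
elim: k1 k2 m N => [|k1 IH] [|k2] m N lt1 lt2 //=.
- by move: lt1 N; rewrite leqn0 => /eqP-> N; apply/matrixP => -[].
- by move: lt2 N; rewrite leqn0 => /eqP-> N; apply/matrixP => -[].
rewrite /CHOL_step; case: ifPn => // /[!(=^~ ltnNge)] m_gt1.
have hlt : (m./2 < m)%N by rewrite -divn2 ltn_Pdiv // (ltn_trans _ m_gt1).
have ult : (uphalf m < m)%N.
  by rewrite ltn_uphalf_double -addnn -(addn1 m) ltn_add2l.
have le1 a b : (a < b)%N -> (b <= k1.+1)%N -> (a <= k1)%N.
  by move=> ab /(leq_trans ab).
have le2 a b : (a < b)%N -> (b <= k2.+1)%N -> (a <= k2)%N.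
  by move=> ab /(leq_trans ab).
rewrite /CHOL_block (IH k2 _ _ (le1 _ _ hlt lt1) (le2 _ _ hlt lt2)).
by rewrite (IH k2 _ _ (le1 _ _ ult lt1) (le2 _ _ ult lt2)).
Qed.

Lemma CHOL_unfold n (M : 'M[C]_n) : CHOL M = CHOL_step CHOL M.
Proof.
rewrite -(CHOL_rec_fuel M (leqnSn n)) /=.
rewrite /CHOL_step; case: ifPn => // /[!(=^~ ltnNge)] n_gt1.
rewrite /CHOL_block !CHOL_rec_fuel //.
  by rewrite leq_uphalf_double -addnn leq_addr.
by rewrite -divn2 leq_div.
Qed.

Definition TRANSH n (H S : 'M[C]_n) : 'M[C]_n :=
  let S_INV := HERM (INV F S) in
  let L := CHOL S_INV in
  HERM (MM F (MM F (L^t*) H) L).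

End Algorithms.

(* Main.v *)
(** The backward error of the block Cholesky algorithm is compared with the
    exact factorization of a Hermitian matrix [M0] whose quadratic form lies
    between [alpha] and [kap * alpha] times the squared norm. Schur complements
    keep these two bounds exactly, so only the distance of the computed block
    [M] to [M0] degrades along the recursion, by a factor [O(kap ^ 3)] per
    level. The number of levels is about [log2 n], which yields the factor
    [kappa S ^ (rho3 * log2 n)].

    The operation [HERM] may amplify an error by a power of [n]. To keep this
    power from being raised to the number of levels, the skew part [M - M^*] is
    followed separately: [HERM X - (HERM X)^*] is diagonal, so its norm is at
    most that of [X - X^*].

    Finally, if [L L^*] is close to [S^-1], then conjugating the output by [L]
    turns [L^* H L] into [L L^* H], which is close to [S^-1 H]. *)

Require Import Defs.
From mathcomp Require Import all_boot all_order all_algebra.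
From mathcomp Require Import sesquilinear spectral.
From mathcomp Require Import complex.
From mathcomp Require Import all_classical all_reals all_analysis.
From mathcomp Require Import ring lra zify.
Import Order.TTheory GRing.Theory Num.Theory.
Local Open Scope classical_set_scope.
Local Open Scope ring_scope.
Local Open Scope complex_scope.
Local Open Scope sesquilinear_scope.

(** [L] is judged only through [L *m L^t*]: that this product is close to [invmx S], and that [L] is
    invertible, is all the similarity requires. Errors are measured in units of [alpha], the
    reciprocal of the norm of [S]; a perturbation of norm at most [alpha / 2] preserves
    invertibility. The reference is the exact Schur complement at every level because the accuracy
    of [INV] depends on a high power of the condition number: the blocks being inverted then have
    condition number at most [4 * kap] whatever the depth, and these powers do not compound. The
    skew part can be followed without powers of [n] building up because the algorithm reads only the
    lower left block [B]: the product [B *m invmx A *m B^t*] fails to be Hermitian only through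
    [invmx A], whose skew part is controlled by that of [A], however far [A] is from its
    reference. *)

Section SpectralNorm.
Set Implicit Arguments.
Unset Strict Implicit.
Context {R : realType}.
Local Notation C := R[i].
Implicit Types (m n p : nat).

(** * Adjoints, the modulus and the real inner product *)

Lemma adjM m n p (A : 'M[C]_(m, n)) (B : 'M[C]_(n, p)) :
  (A *m B)^t* = B^t* *m A^t*.
Proof. by rewrite trmx_mul map_mxM. Qed.

Lemma adjB m n (A B : 'M[C]_(m, n)) : (A - B)^t* = A^t* - B^t*.
Proof. by rewrite linearB map_mxB. Qed.

Lemma adjV n (A : 'M[C]_n) : (invmx A)^t* = invmx (A^t*).
Proof. by rewrite trmx_inv map_invmx. Qed.

Lemma adj_block n1 n2 (A : 'M[C]_n1) B D (E : 'M[C]_n2) :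
  (block_mx A B D E)^t* = block_mx (A^t*) (D^t*) (B^t*) (E^t*).
Proof. by rewrite tr_block_mx map_block_mx. Qed.

Lemma hermsymmxP n (A : 'M[C]_n) : A \is hermsymmx -> A^t* = A.
Proof. by rewrite is_hermitianmxE expr0 scale1r => /eqP <-. Qed.

(** The norm of [R[i]] takes its values in [R[i]]; the modulus is moved to [R] so that estimates
    live in an ordered field where [lra] applies. *)
Definition modc (z : C) : R := complex.Re `|z|.

Lemma modcE z : (modc z)%:C = `|z|.
Proof. by rewrite /modc normc_def. Qed.

Lemma modc_ge0 z : 0 <= modc z.
Proof. by rewrite /modc normc_def sqrtr_ge0. Qed.

Lemma modc0 : modc 0 = 0. Proof. by rewrite /modc normr0. Qed.

Lemma modcM x y : modc (x * y) = modc x * modc y.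
Proof. by apply: (@complexI R); rewrite rmorphM /= !modcE normrM. Qed.

Lemma modcD x y : modc (x + y) <= modc x + modc y.
Proof. by rewrite -lecR rmorphD /= !modcE ler_normD. Qed.

Lemma modcB x y : modc (x - y) <= modc x + modc y.
Proof. by rewrite -lecR rmorphD /= !modcE ler_normB. Qed.

Lemma modcN x : modc (- x) = modc x.
Proof. by rewrite /modc normrN. Qed.

Lemma modc_real (x : R) : modc x%:C = `|x|.
Proof. by rewrite /modc normc_def /= expr0n /= addr0 sqrtr_sqr. Qed.

Lemma modc_sqr (z : C) : modc z ^+ 2 = complex.Re z ^+ 2 + complex.Im z ^+ 2.
Proof. by apply: (@complexI R); rewrite rmorphXn /= modcE add_Re2_Im2. Qed.

(** The real part turns the Hermitian product into the Euclidean inner product of the underlying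
    real space, which is enough for norms and Hermitian forms and is [R]-valued. *)
Definition dotc n (x y : 'cV[C]_n) : R := complex.Re ((x^t* *m y) ord0 ord0).

Lemma dotcE n (x y : 'cV[C]_n) : dotc x y =
  \sum_i (complex.Re (x i ord0) * complex.Re (y i ord0)
          + complex.Im (x i ord0) * complex.Im (y i ord0)).
Proof.
rewrite /dotc mxE (raddf_sum (@complex.Re R : Rcomplex R -> R)) /=.
apply: eq_bigr => i _; rewrite !mxE.
by case: (x i ord0) => a b; case: (y i ord0) => c d /=; rewrite mulNr opprK.
Qed.

Lemma dotc_gt0 n (x y : 'cV[C]_n) : 0 < (x^t* *m y) ord0 ord0 -> 0 < dotc x y.
Proof. by rewrite ltcE => /andP[]. Qed.

Lemma dotcC n (x y : 'cV[C]_n) : dotc x y = dotc y x.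
Proof. by rewrite !dotcE; apply: eq_bigr => i _; ring. Qed.

Lemma dotcDl n (x y z : 'cV[C]_n) : dotc (x + y) z = dotc x z + dotc y z.
Proof.
rewrite !dotcE -big_split; apply: eq_bigr => i _ /=; rewrite !mxE.
by rewrite !raddfD /=; ring.
Qed.

Lemma dotcNl n (x z : 'cV[C]_n) : dotc (- x) z = - dotc x z.
Proof.
rewrite !dotcE -sumrN; apply: eq_bigr => i _ /=; rewrite !mxE.
by rewrite !raddfN /=; ring.
Qed.

Lemma dotcZl n (t : R) (x z : 'cV[C]_n) : dotc (t%:C *: x) z = t * dotc x z.
Proof.
rewrite !dotcE mulr_sumr; apply: eq_bigr => i _ /=; rewrite !mxE.
by case: (x i ord0) => a b /=; ring.
Qed.

Lemma dotcDr n (x y z : 'cV[C]_n) : dotc z (x + y) = dotc z x + dotc z y.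
Proof. by rewrite dotcC dotcDl !(dotcC z). Qed.

Lemma dotcNr n (x z : 'cV[C]_n) : dotc z (- x) = - dotc z x.
Proof. by rewrite dotcC dotcNl (dotcC z). Qed.

Lemma dotcZr n (t : R) (x z : 'cV[C]_n) : dotc z (t%:C *: x) = t * dotc z x.
Proof. by rewrite dotcC dotcZl (dotcC z). Qed.

Lemma dotc0l n (x : 'cV[C]_n) : dotc 0 x = 0.
Proof. by rewrite dotcE big1 // => i _; rewrite !mxE !mul0r addr0. Qed.

Lemma dotc0r n (x : 'cV[C]_n) : dotc x 0 = 0.
Proof. by rewrite dotcC dotc0l. Qed.

Lemma dotc_adj m n (A : 'M[C]_(m, n)) x y : dotc (A *m x) y = dotc x (A^t* *m y).
Proof. by rewrite /dotc adjM mulmxA. Qed.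

Lemma dotcxx n (x : 'cV[C]_n) : dotc x x = \sum_i modc (x i ord0) ^+ 2.
Proof. by rewrite dotcE; apply: eq_bigr => i _; rewrite modc_sqr !expr2. Qed.

Lemma dotcxx_ge0 n (x : 'cV[C]_n) : 0 <= dotc x x.
Proof. by rewrite dotcxx; apply: sumr_ge0 => i _; rewrite sqr_ge0. Qed.

Lemma l2norm_ge0 n (x : 'cV[C]_n) : 0 <= l2norm x.
Proof. exact: sqrtr_ge0. Qed.

Lemma l2norm_sqr n (x : 'cV[C]_n) : l2norm x ^+ 2 = dotc x x.
Proof. by rewrite sqr_sqrtr -dotcxx // dotcxx_ge0. Qed.

Lemma l2norm0 n : l2norm (0 : 'cV[C]_n) = 0.
Proof.
rewrite /l2norm big1 ?sqrtr0 // => i _.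
by rewrite mxE normr0 expr0n.
Qed.

Lemma modc_l2norm n (x : 'cV[C]_n) i : modc (x i ord0) <= l2norm x.
Proof.
rewrite -(@ler_pXn2r _ 2) ?nnegrE ?modc_ge0 ?l2norm_ge0 // l2norm_sqr dotcxx.
by rewrite (bigD1 i) //= lerDl; apply: sumr_ge0 => j _; rewrite sqr_ge0.
Qed.

Lemma l2norm_eq0 n (x : 'cV[C]_n) : l2norm x = 0 -> x = 0.
Proof.
move=> x0; apply/matrixP => i j; rewrite ord1 mxE; apply/eqP.
rewrite -normr_eq0 -modcE (_ : modc _ = 0) //; apply/eqP.
by rewrite eq_le modc_ge0 andbT -x0 modc_l2norm.
Qed.

Lemma l2normZ n (t : R) (x : 'cV[C]_n) : l2norm (t%:C *: x) = `|t| * l2norm x.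
Proof.
apply/eqP; rewrite -(@eqrXn2 _ 2) ?mulr_ge0 ?l2norm_ge0 //.
by rewrite exprMn !l2norm_sqr dotcZl dotcZr real_normK ?num_real // mulrA expr2.
Qed.

Lemma l2normN n (x : 'cV[C]_n) : l2norm (- x) = l2norm x.
Proof.
apply/eqP; rewrite -(@eqrXn2 _ 2) ?l2norm_ge0 //.
by rewrite !l2norm_sqr dotcNl dotcNr opprK.
Qed.

(* Nonnegativity of the real quadratic t |-> q(x + t y) for the form of P. *)
Lemma psd_CauchySchwarz n (P : 'M[C]_n) x y : P^t* = P ->
  (forall z, 0 <= dotc z (P *m z)) ->
  dotc x (P *m y) ^+ 2 <= dotc x (P *m x) * dotc y (P *m y).
Proof.
move=> PH P0; have sym : dotc y (P *m x) = dotc x (P *m y).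
  by rewrite -{1}PH -dotc_adj dotcC.
have q (s t : R) : 0 <= s ^+ 2 * dotc x (P *m x) + 2 * s * t * dotc x (P *m y)
    + t ^+ 2 * dotc y (P *m y).
  move: (P0 (s%:C *: x + t%:C *: y)).
  rewrite mulmxDr -!scalemxAr !(dotcDl, dotcDr, dotcZl, dotcZr) sym.
  move: (dotc x (P *m x)) (dotc x (P *m y)) (dotc y (P *m y)) => a b c.
  by congr (_ <= _); ring.
move: q (P0 x) (P0 y).
move: (dotc x (P *m x)) (dotc x (P *m y)) (dotc y (P *m y)) => {sym P0 PH} a b c q a0 c0.
have [c_gt0|c_le0] := ltP 0 c.
  have := q c (- b).
  rewrite (_ : _ + _ + _ = c * (a * c - b ^+ 2)); last by ring.
  by rewrite pmulr_rge0 // subr_ge0.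
have c_eq0 : c = 0 by apply/eqP; rewrite eq_le c_le0.
rewrite c_eq0 mulr0; have [->|b_neq0] := eqVneq b 0; first by rewrite expr0n.
have := q 1 (- (a + 1) / (2 * b)); rewrite c_eq0 mulr0 addr0 expr1n mul1r.
have -> : 2 * 1 * (- (a + 1) / (2 * b)) * b = - (a + 1) by field.
lra.
Qed.

Lemma dotc_le n (x y : 'cV[C]_n) : dotc x y <= l2norm x * l2norm y.
Proof.
have := @psd_CauchySchwarz n 1%:M x y; rewrite !mul1mx trmx1 map_mx1.
move/(_ erefl) => CS.
have {CS}: dotc x y ^+ 2 <= dotc x x * dotc y y.
  by apply: CS => z; rewrite mul1mx dotcxx_ge0.
rewrite -!l2norm_sqr -exprMn => le_sqr.
apply: le_trans (ler_norm _) _.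
by rewrite -(@ler_pXn2r _ 2) ?nnegrE ?mulr_ge0 ?l2norm_ge0 // real_normK ?num_real.
Qed.

Lemma l2normD n (x y : 'cV[C]_n) : l2norm (x + y) <= l2norm x + l2norm y.
Proof.
rewrite -(@ler_pXn2r _ 2) ?nnegrE ?addr_ge0 ?l2norm_ge0 //.
rewrite l2norm_sqr dotcDl !dotcDr (dotcC y) sqrrD !l2norm_sqr.
have := dotc_le x y; lra.
Qed.

Lemma l2norm_le_sum n (x : 'cV[C]_n) : l2norm x <= \sum_i modc (x i ord0).
Proof.
have s0 : 0 <= \sum_i modc (x i ord0) by apply: sumr_ge0 => i _; exact: modc_ge0.
rewrite -(@ler_pXn2r _ 2) ?nnegrE ?l2norm_ge0 //.
rewrite l2norm_sqr dotcxx expr2 mulr_suml; apply: ler_sum => i _.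
rewrite expr2; apply: ler_wpM2l; first exact: modc_ge0.
rewrite (bigD1 i) //= lerDl; apply: sumr_ge0 => j _; exact: modc_ge0.
Qed.

(** * The spectral norm as an operator norm *)

(** The constant is crude; only its existence matters, since it bounds the set whose supremum is
    [specnorm]. *)
Lemma l2norm_mulmx_bounded m n (A : 'M[C]_(m, n)) :
  exists2 c, 0 <= c & forall x, l2norm (A *m x) <= c * l2norm x.
Proof.
exists (\sum_i \sum_j modc (A i j)) => [|x].
  by apply: sumr_ge0 => i _; apply: sumr_ge0 => j _; exact: modc_ge0.
apply: le_trans (l2norm_le_sum _) _; rewrite mulr_suml; apply: ler_sum => i _.
rewrite mxE mulr_suml.
apply: (@le_trans _ _ (\sum_j modc (A i j * x j ord0))).
  elim/big_rec2: _ => [|j y z _ le_yz]; first by rewrite modc0.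
  by apply: le_trans (modcD _ _) _; rewrite lerD2l.
by apply: ler_sum => j _; rewrite modcM ler_wpM2l ?modc_ge0 ?modc_l2norm.
Qed.

Lemma l2norm_mulmx_le_specnorm m n (A : 'M[C]_(m, n)) x :
  l2norm x = 1 -> l2norm (A *m x) <= specnorm A.
Proof.
have [c c0 Ac] := l2norm_mulmx_bounded A => x1; apply: ub_le_sup; last by exists x.
by exists c => _ [y /= y1 <-]; rewrite (le_trans (Ac y)) // y1 mulr1.
Qed.

Lemma specnorm_ge0 m n (A : 'M[C]_(m, n)) : 0 <= specnorm A.
Proof.
have [|/set0P [_ [x /= x1 _]]] :=
    eqVneq [set l2norm (A *m x) | x in [set x : 'cV[C]_n | l2norm x = 1]] set0.
  by rewrite /specnorm => ->; rewrite sup0.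
exact: le_trans (l2norm_ge0 _) (l2norm_mulmx_le_specnorm A x1).
Qed.

Lemma specnormP m n (A : 'M[C]_(m, n)) x : l2norm (A *m x) <= specnorm A * l2norm x.
Proof.
have [x0|x_neq0] := eqVneq (l2norm x) 0.
  by rewrite (l2norm_eq0 x0) mulmx0 !l2norm0 mulr0.
have x_gt0 : 0 < l2norm x by rewrite lt_neqAle eq_sym x_neq0 l2norm_ge0.
rewrite -ler_pdivrMr // mulrC -[X in X * _]ger0_norm ?invr_ge0 ?l2norm_ge0 //.
rewrite -l2normZ scalemxAr; apply: l2norm_mulmx_le_specnorm.
by rewrite l2normZ ger0_norm ?invr_ge0 ?l2norm_ge0 // mulVf.
Qed.

Lemma specnorm_le m n (A : 'M[C]_(m, n)) c : 0 <= c ->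
  (forall x, l2norm (A *m x) <= c * l2norm x) -> specnorm A <= c.
Proof.
move=> c0 Ac; have [|/set0P ne] :=
    eqVneq [set l2norm (A *m x) | x in [set x : 'cV[C]_n | l2norm x = 1]] set0.
  by rewrite /specnorm => ->; rewrite sup0.
by apply: ge_sup => // _ [y /= y1 <-]; rewrite (le_trans (Ac y)) // y1 mulr1.
Qed.

Lemma specnorm_leP m n (A : 'M[C]_(m, n)) c x :
  specnorm A <= c -> l2norm (A *m x) <= c * l2norm x.
Proof.
move=> Ac; apply: le_trans (specnormP A x) _.
by apply: ler_wpM2r => //; exact: l2norm_ge0.
Qed.

Lemma specnormN m n (A : 'M[C]_(m, n)) : specnorm (- A) = specnorm A.
Proof.
rewrite /specnorm; congr (sup _); apply: eq_imagel => x _.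
by rewrite mulNmx l2normN.
Qed.

Opaque specnorm l2norm dotc modc.

Lemma specnorm_le_ge0 m n (A : 'M[C]_(m, n)) a : specnorm A <= a -> 0 <= a.
Proof. exact: le_trans (specnorm_ge0 A). Qed.

Lemma specnorm_le_add m n (A B : 'M[C]_(m, n)) a b :
  specnorm A <= a -> specnorm B <= b -> specnorm (A + B) <= a + b.
Proof.
move=> Aa Bb; apply: specnorm_le => [|x].
  by rewrite addr_ge0 ?(specnorm_le_ge0 Aa) ?(specnorm_le_ge0 Bb).
rewrite mulmxDl mulrDl; apply: le_trans (l2normD _ _) _.
by rewrite lerD // specnorm_leP.
Qed.

Lemma specnorm_distC m n (A B : 'M[C]_(m, n)) : specnorm (A - B) = specnorm (B - A).
Proof. by rewrite -specnormN opprB. Qed.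

Lemma specnorm_le_sub m n (A B : 'M[C]_(m, n)) a b :
  specnorm A <= a -> specnorm B <= b -> specnorm (A - B) <= a + b.
Proof. by move=> Aa; rewrite -(specnormN B); exact: specnorm_le_add Aa. Qed.

Lemma specnorm_le_perturb m n (A B : 'M[C]_(m, n)) a b :
  specnorm (A - B) <= a -> specnorm B <= b -> specnorm A <= a + b.
Proof. by move=> Aa Bb; rewrite -[A](subrK B); exact: specnorm_le_add. Qed.

Lemma specnorm_le_mul m n p (A : 'M[C]_(m, n)) (B : 'M[C]_(n, p)) a b :
  specnorm A <= a -> specnorm B <= b -> specnorm (A *m B) <= a * b.
Proof.
move=> Aa Bb; have a0 : 0 <= a := specnorm_le_ge0 Aa.
have b0 : 0 <= b := specnorm_le_ge0 Bb.
apply: specnorm_le => [|x]; first exact: mulr_ge0.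
rewrite -mulmxA -mulrA; apply: le_trans (specnorm_leP _ Aa) _.
by apply: ler_wpM2l => //; exact: specnorm_leP.
Qed.

Lemma sqr_l2norm_adj m n (A : 'M[C]_(m, n)) x :
  l2norm (A^t* *m x) ^+ 2 <= specnorm (A *m A^t*) * l2norm x ^+ 2.
Proof.
rewrite l2norm_sqr dotc_adj trmxCK mulmxA.
apply: le_trans (dotc_le _ _) _.
by rewrite expr2 mulrCA ler_wpM2l ?l2norm_ge0 // specnormP.
Qed.

(** The squared norm of [A^t* *m x] is the inner product of [x] with [A *m (A^t* *m x)];
    Cauchy-Schwarz and division by the norm of [A^t* *m x] give the bound. *)
Lemma specnorm_adj_le m n (A : 'M[C]_(m, n)) : specnorm (A^t*) <= specnorm A.
Proof.
apply: specnorm_le => [|x]; first exact: specnorm_ge0.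
have [->|] := eqVneq (l2norm (A^t* *m x)) 0; first by rewrite mulr_ge0 ?specnorm_ge0 ?l2norm_ge0.
move=> ne; have gt0 : 0 < l2norm (A^t* *m x) by rewrite lt_neqAle eq_sym ne l2norm_ge0.
rewrite -(ler_pM2r gt0) -expr2 l2norm_sqr dotc_adj trmxCK.
apply: le_trans (dotc_le _ _) _.
by rewrite mulrC -mulrA [X in _ <= _ * X]mulrC mulrA ler_wpM2r ?l2norm_ge0 // specnormP.
Qed.

Lemma specnorm_adj m n (A : 'M[C]_(m, n)) : specnorm (A^t*) = specnorm A.
Proof.
apply/eqP; rewrite eq_le specnorm_adj_le /=.
by rewrite -{1}(trmxCK A) specnorm_adj_le.
Qed.

(** This is how bounds on [L *m L^t*] become bounds on [L]. *)
Lemma sqr_specnorm m n (A : 'M[C]_(m, n)) : specnorm A ^+ 2 <= specnorm (A *m A^t*).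
Proof.
have s0 := specnorm_ge0 (A *m A^t*).
rewrite -(sqr_sqrtr s0) ler_pXn2r ?nnegrE ?specnorm_ge0 ?sqrtr_ge0 //.
rewrite -specnorm_adj; apply: specnorm_le => [|x]; first exact: sqrtr_ge0.
rewrite -(@ler_pXn2r _ 2) ?nnegrE ?mulr_ge0 ?sqrtr_ge0 ?l2norm_ge0 //.
by rewrite exprMn (sqr_sqrtr s0) sqr_l2norm_adj.
Qed.

Lemma dotc_col_mx n1 n2 (x x' : 'cV[C]_n1) (y y' : 'cV[C]_n2) :
  dotc (col_mx x y) (col_mx x' y') = dotc x x' + dotc y y'.
Proof.
rewrite !dotcE big_split_ord /=; congr (_ + _); apply: eq_bigr => i _.
  by rewrite !col_mxEu.
by rewrite !col_mxEd.
Qed.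

Lemma l2norm_col_mx0 n1 n2 (x : 'cV[C]_n1) : l2norm (col_mx x (0 : 'cV[C]_n2)) = l2norm x.
Proof.
apply/eqP; rewrite -(@eqrXn2 _ 2) ?l2norm_ge0 // !l2norm_sqr dotc_col_mx.
by rewrite -!l2norm_sqr l2norm0 expr0n addr0.
Qed.

Lemma l2norm_col_0mx n1 n2 (y : 'cV[C]_n2) : l2norm (col_mx (0 : 'cV[C]_n1) y) = l2norm y.
Proof.
apply/eqP; rewrite -(@eqrXn2 _ 2) ?l2norm_ge0 // !l2norm_sqr dotc_col_mx.
by rewrite -!l2norm_sqr l2norm0 expr0n add0r.
Qed.

Lemma l2norm_col_mxu n1 n2 (x : 'cV[C]_n1) (y : 'cV[C]_n2) : l2norm x <= l2norm (col_mx x y).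
Proof.
rewrite -(@ler_pXn2r _ 2) ?nnegrE ?l2norm_ge0 // !l2norm_sqr dotc_col_mx.
by rewrite lerDl dotcxx_ge0.
Qed.

Lemma l2norm_col_mxd n1 n2 (x : 'cV[C]_n1) (y : 'cV[C]_n2) : l2norm y <= l2norm (col_mx x y).
Proof.
rewrite -(@ler_pXn2r _ 2) ?nnegrE ?l2norm_ge0 // !l2norm_sqr dotc_col_mx.
by rewrite lerDr dotcxx_ge0.
Qed.

Lemma l2norm_col_mx_le n1 n2 (x : 'cV[C]_n1) (y : 'cV[C]_n2) :
  l2norm (col_mx x y) <= l2norm x + l2norm y.
Proof.
rewrite -[X in X + _](@l2norm_col_mx0 n1 n2) -[X in _ + X](@l2norm_col_0mx n1 n2).
by apply: le_trans _ (l2normD _ _); rewrite add_col_mx addr0 add0r.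
Qed.

Lemma specnorm_block n1 n2 (A : 'M[C]_n1) B D (E : 'M[C]_n2) a b d e :
  specnorm A <= a -> specnorm B <= b -> specnorm D <= d -> specnorm E <= e ->
  specnorm (block_mx A B D E) <= a + b + d + e.
Proof.
move=> Aa Bb Dd Ee;
apply: specnorm_le => [|v]; first by rewrite !addr_ge0
    ?(specnorm_le_ge0 Aa) ?(specnorm_le_ge0 Bb) ?(specnorm_le_ge0 Dd) ?(specnorm_le_ge0 Ee).
rewrite -[v]vsubmxK; set x := usubmx v; set y := dsubmx v.
rewrite mul_block_col; apply: le_trans (l2norm_col_mx_le _ _) _.
have xl := l2norm_col_mxu x y; have yl := l2norm_col_mxd x y.
have bnd p q (X : 'M[C]_(p, q)) c z : specnorm X <= c -> l2norm z <= l2norm (col_mx x y) ->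
    l2norm (X *m z) <= c * l2norm (col_mx x y).
  move=> Xc zl; apply: le_trans (specnorm_leP _ Xc) _.
  by apply: ler_wpM2l => //; exact: specnorm_le_ge0 Xc.
rewrite -[a + b + d + e]addrA [(_ + _) * _]mulrDl lerD //.
  by rewrite mulrDl (le_trans (l2normD _ _)) // lerD // bnd.
by rewrite mulrDl (le_trans (l2normD _ _)) // lerD // bnd.
Qed.

Lemma specnorm_blocks n1 n2 (A : 'M[C]_n1) B D (E : 'M[C]_n2) c :
  specnorm (block_mx A B D E) <= c ->
  [/\ specnorm A <= c, specnorm B <= c, specnorm D <= c & specnorm E <= c].
Proof.
move=> Mc; have c0 : 0 <= c := specnorm_le_ge0 Mc.
have bnd1 (z : 'cV_n1) : l2norm (A *m z) <= c * l2norm z /\ l2norm (D *m z) <= c * l2norm z.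
  have := specnorm_leP (col_mx z (0 : 'cV_n2)) Mc.
  rewrite mul_block_col !mulmx0 !addr0 l2norm_col_mx0 => le_c.
  by split; apply: le_trans le_c; rewrite ?l2norm_col_mxu ?l2norm_col_mxd.
have bnd2 (z : 'cV_n2) : l2norm (B *m z) <= c * l2norm z /\ l2norm (E *m z) <= c * l2norm z.
  have := specnorm_leP (col_mx (0 : 'cV_n1) z) Mc.
  rewrite mul_block_col !mulmx0 !add0r l2norm_col_0mx => le_c.
  by split; apply: le_trans le_c; rewrite ?l2norm_col_mxu ?l2norm_col_mxd.
by split; apply: specnorm_le => // z;
  [case: (bnd1 z) | case: (bnd2 z) | case: (bnd1 z) | case: (bnd2 z)].
Qed.

Lemma modc_le_specnorm m n (A : 'M[C]_(m, n)) i j : modc (A i j) <= specnorm A.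
Proof.
have l1 : l2norm (delta_mx j ord0 : 'cV[C]_n) = 1.
  apply/eqP; rewrite -(@eqrXn2 _ 2) ?l2norm_ge0 // l2norm_sqr dotcxx (bigD1 j) //=.
  rewrite big1 => [|k /negPf kj]; first by rewrite mxE !eqxx modc_real normr1 addr0.
  by rewrite mxE kj modc0 expr0n.
apply: le_trans (l2norm_mulmx_le_specnorm A l1); rewrite -colE.
by apply: le_trans (modc_l2norm _ i); rewrite mxE.
Qed.

(** The origin of the weight [Q]: the effects of [HERM] and of [fl_subm] are known only entry by
    entry. *)
Lemma specnorm_entries n (A : 'M[C]_n) c : 0 <= c ->
  (forall i j, modc (A i j) <= c) -> specnorm A <= n%:R ^+ 2 * c.
Proof.
move=> c0 Ac; apply: specnorm_le => [|x]; first by rewrite mulr_ge0 ?sqr_ge0.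
apply: le_trans (l2norm_le_sum _) _.
apply: (@le_trans _ _ (\sum_(i < n) \sum_(j < n) c * l2norm x)).
  apply: ler_sum => i _; rewrite mxE.
  apply: (@le_trans _ _ (\sum_j modc (A i j * x j ord0))).
    elim/big_rec2: _ => [|j y z _ le_yz]; first by rewrite modc0.
    by apply: le_trans (modcD _ _) _; rewrite lerD2l.
  by apply: ler_sum => j _; rewrite modcM ler_pM ?modc_ge0 ?modc_l2norm.
by rewrite !sumr_const !card_ord -mulrnA -[leLHS]mulr_natl natrM expr2 -[leRHS]mulrA; exact: lexx.
Qed.

(** In contrast to the general entrywise bound, no power of [n] is lost; the estimate for the skew
    part of [HERM] rests on this. *)
Lemma specnorm_diag n (A : 'M[C]_n) c : 0 <= c ->
  (forall i j, i != j -> A i j = 0) -> (forall i, modc (A i i) <= c) ->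
  specnorm A <= c.
Proof.
move=> c0 A0 Ac; apply: specnorm_le => // x.
rewrite -(@ler_pXn2r _ 2) ?nnegrE ?mulr_ge0 ?l2norm_ge0 //.
rewrite exprMn !l2norm_sqr !dotcxx mulr_sumr; apply: ler_sum => i _.
rewrite mxE (bigD1 i) //= big1 => [|j ji]; last by rewrite A0 ?mul0r // eq_sym.
rewrite addr0 modcM exprMn ler_wpM2r ?sqr_ge0 //.
by rewrite ler_pXn2r ?nnegrE ?modc_ge0.
Qed.

(** * Invertibility under perturbation *)

Lemma inj_unitmx n (A : 'M[C]_n) : (forall x : 'cV_n, A *m x = 0 -> x = 0) -> A \in unitmx.
Proof.
move=> Ainj; rewrite -unitmx_tr -row_free_unit -kermx_eq0.
apply/rowV0P => v /sub_kermxP vA0; apply: trmx_inj; rewrite trmx0; apply: Ainj.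
by rewrite -[A]trmxK -trmx_mul vA0 trmx0.
Qed.

Lemma bounded_below_unitmx n (A : 'M[C]_n) c : 0 <= c ->
  (forall x, l2norm x <= c * l2norm (A *m x)) ->
  A \in unitmx /\ specnorm (invmx A) <= c.
Proof.
move=> c0 Ac; have Au : A \in unitmx.
  apply: inj_unitmx => x Ax0; apply: l2norm_eq0; apply/eqP.
  rewrite eq_le l2norm_ge0 andbT; apply: le_trans (Ac _) _.
  by rewrite Ax0 l2norm0 mulr0.
split=> //; apply: specnorm_le => // x.
by apply: le_trans (Ac _) _; rewrite mulmxA mulmxV // mul1mx.
Qed.

(** The reverse triangle inequality bounds the norm of [A *m x] below by that of [A0 *m x] minus [r]
    times that of [x], and [r * g <= 1 / 2] lets half of the lower bound survive. *)
Lemma perturbed_unitmx n (A A0 : 'M[C]_n) g r : A0 \in unitmx ->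
  specnorm (invmx A0) <= g -> specnorm (A - A0) <= r -> r * g <= 1 / 2 ->
  A \in unitmx /\ specnorm (invmx A) <= 2 * g.
Proof.
move=> A0u A0g Ar rg; have g0 : 0 <= g := specnorm_le_ge0 A0g.
apply: bounded_below_unitmx => [|x]; first exact: mulr_ge0.
have h1 : l2norm x <= g * l2norm (A0 *m x).
  by have := specnorm_leP (A0 *m x) A0g; rewrite mulKmx.
have h2 : l2norm (A0 *m x) <= l2norm (A *m x) + r * l2norm x.
  have -> : A0 *m x = A *m x - (A - A0) *m x by rewrite mulmxBl opprB addrC subrK.
  apply: le_trans (l2normD _ _) _; rewrite l2normN lerD2l.
  exact: specnorm_leP.
have h3 : g * l2norm (A0 *m x) <= g * l2norm (A *m x) + g * r * l2norm x.
  by rewrite -mulrA -mulrDr ler_wpM2l.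
have h4 : g * r * l2norm x <= 1 / 2 * l2norm x by rewrite ler_wpM2r ?l2norm_ge0 // mulrC.
move: h1 h3 h4 => {h2 A0g Ar A0u}.
move: (l2norm x) (l2norm (A0 *m x)) (l2norm (A *m x)) => x1 x2 x3; lra.
Qed.

(** The resolvent identity. It serves twice: for [A] against its reference [A0], and for [A] against
    its own adjoint, where it transfers the skew part to the inverse. *)
Lemma specnorm_invmxB n (A B : 'M[C]_n) a b r : A \in unitmx -> B \in unitmx ->
  specnorm (invmx A) <= a -> specnorm (invmx B) <= b -> specnorm (A - B) <= r ->
  specnorm (invmx A - invmx B) <= a * r * b.
Proof.
move=> Au Bu Aa Bb ABr.
have -> : invmx A - invmx B = invmx A *m (B - A) *m invmx B.
  by rewrite mulmxBr mulVmx // mulmxBl mul1mx -mulmxA mulmxV // mulmx1 //.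
apply: specnorm_le_mul Bb; apply: specnorm_le_mul Aa _.
rewrite specnorm_distC; exact: ABr.
Qed.

End SpectralNorm.

Local Opaque specnorm l2norm dotc modc.

(** * Two-sided bounds on Hermitian forms, and the effect of [HERM] *)

Section PositiveDefinite.
Set Implicit Arguments.
Unset Strict Implicit.
Context {R : realType}.
Local Notation C := R[i].
Implicit Types (m n p : nat).

(** A spectral interval expressed by the quadratic form, so that it passes to blocks and Schur
    complements without diagonalization. *)
Definition hermitian_between n (a b : R) (M : 'M[C]_n) : Prop :=
  M^t* = M /\
  forall x, a * l2norm x ^+ 2 <= dotc x (M *m x) <= b * l2norm x ^+ 2.

Lemma hermitian_between_psd n (a b : R) (M : 'M[C]_n) : 0 <= a ->
  hermitian_between a b M -> forall x, 0 <= dotc x (M *m x).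
Proof.
move=> a0 [_ Mab] x; have /andP[+ _] := Mab x.
by apply: le_trans; rewrite mulr_ge0 ?sqr_ge0.
Qed.

(** Cauchy-Schwarz for the form of [M], applied to [M *m x] and [x], bounds the fourth power of the
    norm of [M *m x]; the bound [b] and a division remove one square. This replaces an appeal to the
    square root of [M]. *)
Lemma psd_l2norm_mulmx n (M : 'M[C]_n) (b : R) x : M^t* = M ->
  (forall z, 0 <= dotc z (M *m z)) ->
  (forall z, dotc z (M *m z) <= b * l2norm z ^+ 2) ->
  l2norm (M *m x) ^+ 2 <= b * dotc x (M *m x).
Proof.
move=> MH M0 Mb; have [->|ne0] := eqVneq (M *m x) 0.
  by rewrite l2norm0 expr0n dotc0r mulr0.
have gt0 : 0 < l2norm (M *m x) ^+ 2.
  rewrite exprn_gt0 // lt_neqAle l2norm_ge0 andbT eq_sym.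
  by apply/eqP => /l2norm_eq0/eqP; apply/negP.
have := psd_CauchySchwarz (M *m x) x MH M0.
rewrite -l2norm_sqr => CS; rewrite -(ler_pM2r gt0) -expr2.
apply: le_trans CS _; rewrite [leRHS]mulrAC; apply: ler_wpM2r (M0 x) _ _ _.
exact: Mb.
Qed.

Lemma hermitian_between_norm n (a b : R) (M : 'M[C]_n) : 0 <= a -> 0 <= b ->
  hermitian_between a b M -> specnorm M <= b.
Proof.
move=> a0 b0 Mab; have M0 := hermitian_between_psd a0 Mab; case: Mab => MH Mab.
have Mb z : dotc z (M *m z) <= b * l2norm z ^+ 2 by case/andP: (Mab z).
apply: (specnorm_le b0) => x.
rewrite -(@ler_pXn2r _ 2) ?nnegrE ?mulr_ge0 ?l2norm_ge0 // exprMn.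
apply: le_trans (psd_l2norm_mulmx _ MH M0 Mb) _.
rewrite expr2 -mulrA; apply: ler_wpM2l b0 _ _ _; exact: Mb.
Qed.

Lemma hermitian_between_inv n (a b : R) (M : 'M[C]_n) : 0 < a ->
  hermitian_between a b M -> M \in unitmx /\ specnorm (invmx M) <= a^-1.
Proof.
move=> a0 [_ Mab]; apply: bounded_below_unitmx => [|x]; first by rewrite invr_ge0 ltW.
have [->|ne0] := eqVneq (l2norm x) 0.
  by rewrite mulr_ge0 ?invr_ge0 ?l2norm_ge0 // ltW.
have gt0 : 0 < l2norm x by rewrite lt_neqAle eq_sym ne0 l2norm_ge0.
rewrite mulrC ler_pdivlMr // -(ler_pM2r gt0) mulrAC -expr2 mulrC.
have /andP[+ _] := Mab x; move/le_trans; apply.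
rewrite mulrC; exact: dotc_le.
Qed.

Section Blocks.
Context {n1 n2 : nat} {a b : R}.
Context {A : 'M[C]_n1} {B : 'M[C]_(n2, n1)} {D : 'M[C]_n2}.
Hypothesis M_ab : hermitian_between a b (block_mx A (B^t*) B D).

Lemma hermitian_between_ul : hermitian_between a b A.
Proof.
case: M_ab => MH Mab; split.
  by move: MH; rewrite adj_block => /eq_block_mx[].
move=> x; have := Mab (col_mx x 0).
by rewrite mul_block_col !mulmx0 !addr0 dotc_col_mx dotc0l addr0 l2norm_col_mx0.
Qed.

(** The form of the Schur complement at [x] is the form of the whole matrix at the vector extending
    [x] that annihilates the upper block, which gives the lower bound. The upper bound holds because
    a positive semidefinite matrix is subtracted from [D]. *)
Lemma hermitian_between_schur : 0 < a ->
  hermitian_between a b (D - B *m invmx A *m B^t*).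
Proof.
move=> a0; have [Au _] := hermitian_between_inv a0 hermitian_between_ul.
have [AH _] := hermitian_between_ul; case: M_ab => MH Mab.
have DH : D^t* = D by move: MH; rewrite adj_block => /eq_block_mx[].
split; first by rewrite adjB !adjM trmxCK adjV AH DH mulmxA.
move=> x; apply/andP; split.
  (* This [y] minimizes the form of the block matrix for fixed [x]: the upper component of the image
     vanishes. *)
  pose y := - (invmx A *m (B^t* *m x)).
  have /andP[+ _] := Mab (col_mx y x).
  have -> : block_mx A (B^t*) B D *m col_mx y x
          = col_mx 0 ((D - B *m invmx A *m B^t*) *m x).
    rewrite mul_block_col /y !mulmxN mulKVmx // addNr; congr col_mx.
    by rewrite mulmxBl addrC !mulmxA.
  rewrite dotc_col_mx dotc0r add0r; apply: le_trans.
  apply: ler_wpM2l; first exact: ltW.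
  by rewrite ler_pXn2r ?nnegrE ?l2norm_ge0 // l2norm_col_mxd.
have /andP[_ +] := Mab (col_mx 0 x).
rewrite mul_block_col !mulmx0 !add0r dotc_col_mx dotc0l add0r l2norm_col_0mx.
apply: le_trans; rewrite mulmxBl dotcDr dotcNr gerBl.
have := hermitian_between_psd (ltW a0) hermitian_between_ul (invmx A *m (B^t* *m x)).
by rewrite mulKVmx // dotcC dotc_adj trmxCK !mulmxA.
Qed.

End Blocks.

Lemma posdefmx_gt0 n (S : 'M[C]_n) x : posdefmx S -> x != 0 -> 0 < dotc x (S *m x).
Proof.
by case=> _ Spd /Spd; rewrite -mulmxA => /dotc_gt0.
Qed.

Lemma posdefmx_unit n (S : 'M[C]_n) : posdefmx S -> S \in unitmx.
Proof.
move=> Spd; apply: inj_unitmx => x Sx0; apply/eqP; apply: contraT => x0.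
by have := posdefmx_gt0 Spd x0; rewrite Sx0 dotc0r ltxx.
Qed.

Lemma posdefmx_between_inv n (S : 'M[C]_n) : (0 < n)%N -> posdefmx S ->
  0 < specnorm S /\ hermitian_between (specnorm S)^-1 (specnorm (invmx S)) (invmx S).
Proof.
move=> n0 Spd; have Su := posdefmx_unit Spd.
have SH : S^t* = S by apply: hermsymmxP; case: Spd.
have S0 z : 0 <= dotc z (S *m z).
  have [->|z0] := eqVneq z 0; first by rewrite mulmx0 dotc0r.
  exact/ltW/posdefmx_gt0.
have Sb z : dotc z (S *m z) <= specnorm S * l2norm z ^+ 2.
  apply: le_trans (dotc_le _ _) _.
  rewrite expr2 mulrCA; apply: ler_wpM2l (l2norm_ge0 _) _ _ _; exact: specnormP.
have s_gt0 : 0 < specnorm S.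
  rewrite lt_neqAle specnorm_ge0 andbT eq_sym; apply/eqP => s0.
  case: n n0 S Spd {Su SH S0} Sb s0 => // n _ S Spd Sb s0.
  have : delta_mx ord0 ord0 != 0 :> 'cV[C]_n.+1.
    apply/eqP => /matrixP /(_ ord0 ord0) /eqP; by rewrite !mxE !eqxx oner_eq0.
  move/(posdefmx_gt0 Spd); rewrite ltNge => /negP; apply.
  by apply: le_trans (Sb _) _; rewrite s0 mul0r.
split=> //; split; first by rewrite adjV SH.
move=> x; apply/andP; split.
  rewrite mulrC ler_pdivrMr //.
  (* Taken at [invmx S *m x], the upper bound on the form of [S] becomes a lower bound on the form
     of its inverse. *)
  have := psd_l2norm_mulmx (invmx S *m x) SH S0 Sb.
  by rewrite mulKVmx // dotcC mulrC.
apply: le_trans (dotc_le _ _) _.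
rewrite expr2 mulrCA; apply: ler_wpM2l (l2norm_ge0 _) _ _ _; exact: specnormP.
Qed.

Lemma HERM_skew_le n (X : 'M[C]_n) :
  specnorm (HERM X - (HERM X)^t*) <= specnorm (X - X^t*).
Proof.
apply: specnorm_diag => [|i j ij|i]; first exact: specnorm_ge0.
  rewrite !mxE; case: (ltngtP i j) => [lt_ij|lt_ji|eq_ij].
  - by rewrite conjCK subrr.
  - by rewrite subrr.
  - by move: ij; rewrite (val_inj eq_ij) eqxx.
rewrite !mxE leqnn; have := modc_le_specnorm (X - X^t*) i i.
by rewrite !mxE.
Qed.

(** [HERM] changes only entries below the diagonal, and the change there is an entry of [X - X^t*]
    up to sign. *)
Lemma HERM_sub_le n (X : 'M[C]_n) :
  specnorm (HERM X - X) <= n%:R ^+ 2 * specnorm (X - X^t*).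
Proof.
apply: specnorm_entries => [|i j]; first exact: specnorm_ge0.
rewrite !mxE; case: leqP => _; first by rewrite subrr modc0 specnorm_ge0.
have := modc_le_specnorm (X - X^t*) i j.
by rewrite !mxE -modcN opprB.
Qed.

Lemma specnorm_skew_le n (X X0 : 'M[C]_n) r : X0^t* = X0 ->
  specnorm (X - X0) <= r -> specnorm (X - X^t*) <= r + r.
Proof.
move=> X0H Xr; have -> : X - X^t* = (X - X0) - (X - X0)^t*.
  by rewrite adjB X0H opprB addrA subrK.
by apply: (specnorm_le_sub Xr); rewrite specnorm_adj.
Qed.

End PositiveDefinite.

(** * One step of block Cholesky in floating point *)

Section BackwardError.
Set Implicit Arguments.
Unset Strict Implicit.
Context {R : realType}.
Local Notation C := R[i].
Implicit Types (m n p : nat).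

Lemma eq_ler (x y : R) : x = y -> x <= y. Proof. by move=> ->. Qed.

(* The bound [4 * kap] covers every leading block met in the recursion. *)
Record fp_accurate (N : nat) (nu kap : R) (F : fparith R) : Prop := FPAccurate {
  acc_sub : forall a b, modc (fl_sub F a b - (a - b)) <= nu * modc (a - b);
  acc_sqrt : forall a, exists2 d, modc d <= nu & fl_sqrt F a = (1 + d) * sqrtc a;
  acc_MM : forall m n p (X : 'M[C]_(m, n)) (Y : 'M[C]_(n, p)),
    (0 < m <= N)%N -> (0 < n <= N)%N -> (0 < p <= N)%N ->
    specnorm (MM F X Y - X *m Y) <= nu * specnorm X * specnorm Y;
  acc_INV : forall m (X : 'M[C]_m), (0 < m <= N)%N -> X \in unitmx ->
    kappa X <= 4 * kap ->
    specnorm (INV F X - invmx X) <= nu * specnorm (invmx X)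
}.

Context {N : nat} {F : fparith R} {nu kap alpha : R}.
Hypothesis F_acc : fp_accurate N nu kap F.
Hypothesis nu_ge0 : 0 <= nu.
Hypothesis kap_ge1 : 1 <= kap.
Hypothesis alpha_gt0 : 0 < alpha.

Lemma acc_MM_le m n p (X : 'M[C]_(m, n)) (Y : 'M[C]_(n, p)) x y :
  (0 < m <= N)%N -> (0 < n <= N)%N -> (0 < p <= N)%N ->
  specnorm X <= x -> specnorm Y <= y ->
  specnorm (MM F X Y - X *m Y) <= nu * x * y.
Proof.
move=> hm hn hp Xx Yy; apply: le_trans (acc_MM F_acc X Y hm hn hp) _.
apply: ler_pM Yy; rewrite ?mulr_ge0 ?specnorm_ge0 //.
exact: ler_wpM2l Xx.
Qed.

Lemma fl_subm_le n (X Y : 'M[C]_n) x : specnorm (X - Y) <= x ->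
  specnorm (fl_subm F X Y - (X - Y)) <= n%:R ^+ 2 * (nu * x).
Proof.
move=> XYx; apply: specnorm_entries => [|i j].
  by rewrite mulr_ge0 // (specnorm_le_ge0 XYx).
rewrite !mxE; apply: le_trans (acc_sub F_acc _ _) _.
apply: ler_wpM2l => //; apply: le_trans XYx.
have := modc_le_specnorm (X - Y) i j; by rewrite !mxE.
Qed.

Section Step.
Context {n1 n2 : nat} {a Q t : R}.
Context {A A0 : 'M[C]_n1} {B B0 : 'M[C]_(n2, n1)} {D D0 : 'M[C]_n2}.
Hypothesis n1_le : (0 < n1 <= N)%N.
Hypothesis n2_le : (0 < n2 <= N)%N.
Hypothesis Q_ge1 : 1 <= Q.
Hypothesis n2_Q : n2%:R ^+ 2 <= Q.
(** [a * alpha] is the common error unit. Two factors [Q] guard the rounding term: the entrywise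
    subtraction loses one, and the weight on the skew part contributes the other. The constant
    [2048] below is [8 * 256], matching the error [8 * K ^ d * a] of the recursion with
    [K = 256 * kap ^ 3]. *)
Hypothesis a_ge : Q ^+ 2 * nu * kap <= a.
Hypothesis a_le : 2048 * kap ^+ 3 * a <= 1.
Hypothesis M0_ab : hermitian_between alpha (kap * alpha) (block_mx A0 (B0^t*) B0 D0).
Hypothesis A_A0 : specnorm (A - A0) <= a * alpha.
Hypothesis B_B0 : specnorm (B - B0) <= a * alpha.
Hypothesis D_D0 : specnorm (D - D0) <= a * alpha.
Hypothesis A_skew : specnorm (A - A^t*) <= t.
Hypothesis D_skew : specnorm (D - D^t*) <= t.
Hypothesis t_le : Q * t <= a * alpha.

Let W := MM F B (INV F A).
Let W0 := B0 *m invmx A0.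
Let X := MM F W (B^t*).
Let St := fl_subm F D (HERM X).
Let S0 := D0 - B0 *m invmx A0 *m B0^t*.

Let kap_ge0 : 0 <= kap. Proof. exact: le_trans kap_ge1. Qed.
Let Q_ge0 : 0 <= Q. Proof. exact: le_trans Q_ge1. Qed.
Let a_ge0 : 0 <= a. Proof. by apply: le_trans a_ge; rewrite !mulr_ge0. Qed.
Let alpha_ge0 : 0 <= alpha. Proof. exact: ltW. Qed.
Let alpha_neq0 : alpha != 0. Proof. by rewrite gt_eqF. Qed.
Let kap_le_sqr : kap <= kap ^+ 2. Proof. by rewrite expr2 ler_peMl. Qed.
Let sqr_le_cube : kap ^+ 2 <= kap ^+ 3.
Proof. by rewrite exprS ler_peMl ?sqr_ge0. Qed.

Let a_small : 2048 * a <= 1.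
Proof.
apply: le_trans a_le; apply: ler_wpM2r => //.
have := kap_le_sqr; have := sqr_le_cube; have := kap_ge1; lra.
Qed.

Let kap2_a : 2048 * (kap ^+ 2 * a) <= 1.
Proof.
apply: le_trans a_le; rewrite mulrA; apply: ler_wpM2r => //.
have := sqr_le_cube; lra.
Qed.

Let Q_nu : Q * nu * kap <= a.
Proof.
apply: le_trans a_ge; rewrite expr2 -!mulrA; apply: ler_peMl => //.
by rewrite !mulr_ge0 // (le_trans _ Q_ge1).
Qed.

Let nu_kap : nu * kap <= a.
Proof.
apply: le_trans Q_nu; rewrite -mulrA; apply: ler_peMl => //; exact: mulr_ge0.
Qed.

Let nu_le : nu <= a.
Proof. by apply: le_trans nu_kap; apply: ler_peMr. Qed.

Let A0_ab := hermitian_between_ul M0_ab.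

Let beta_ge0 : 0 <= kap * alpha. Proof. exact: mulr_ge0. Qed.

Let M0_norm : specnorm (block_mx A0 (B0^t*) B0 D0) <= kap * alpha.
Proof. exact: hermitian_between_norm alpha_ge0 beta_ge0 M0_ab. Qed.

Let A0_norm : specnorm A0 <= kap * alpha.
Proof. by case: (specnorm_blocks M0_norm). Qed.

Let B0_norm : specnorm B0 <= kap * alpha.
Proof. by case: (specnorm_blocks M0_norm). Qed.

Let B_norm : specnorm B <= 2 * (kap * alpha).
Proof.
apply: le_trans (specnorm_le_perturb B_B0 B0_norm) _.
rewrite -mulrDl mulrA; apply: ler_wpM2r => //.
have := a_small; have := kap_ge1; lra.
Qed.

Let A0_unit : A0 \in unitmx.
Proof. by case: (hermitian_between_inv alpha_gt0 A0_ab). Qed.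

Let A0_inv : specnorm (invmx A0) <= alpha^-1.
Proof. by case: (hermitian_between_inv alpha_gt0 A0_ab). Qed.

Let A_unit_inv : A \in unitmx /\ specnorm (invmx A) <= 2 * alpha^-1.
Proof.
apply: (perturbed_unitmx A0_unit A0_inv A_A0); rewrite mulfK //.
have := a_small; have := a_ge0; lra.
Qed.

Let A_inv : specnorm (invmx A) <= 2 * alpha^-1. Proof. by case: A_unit_inv. Qed.

Let V_inv : specnorm (INV F A - invmx A) <= 2 * nu * alpha^-1.
Proof.
have [Au _] := A_unit_inv; apply: le_trans (acc_INV F_acc n1_le Au _) _.
  (* With the bound [2 * alpha^-1] on the inverse this gives [kappa A <= 4 * kap], the range in
     which [fp_accurate] controls [INV]. *)
  have A_norm : specnorm A <= 2 * (kap * alpha).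
    apply: le_trans (specnorm_le_perturb A_A0 A0_norm) _.
    rewrite -mulrDl mulrA; apply: ler_wpM2r => //.
    have := a_small; have := kap_ge1; lra.
  apply: le_trans (ler_pM _ _ A_norm A_inv) _; rewrite ?specnorm_ge0 //.
  by apply: eq_ler; field.
rewrite (mulrC 2) -mulrA; exact: ler_wpM2l A_inv.
Qed.

Let V_A0 : specnorm (INV F A - invmx A0) <= 4 * a * alpha^-1.
Proof.
have [Au _] := A_unit_inv.
rewrite -(subrK (invmx A) (INV F A)) -addrA.
apply: le_trans (specnorm_le_add V_inv (specnorm_invmxB Au A0_unit A_inv A0_inv A_A0)) _.
have -> : 2 * alpha^-1 * (a * alpha) * alpha^-1 = 2 * a * alpha^-1 by field.
rewrite -mulrDl; apply: ler_wpM2r; first by rewrite invr_ge0.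
have := nu_le; lra.
Qed.

Let V_norm : specnorm (INV F A) <= 4 * alpha^-1.
Proof.
apply: le_trans (specnorm_le_perturb V_A0 A0_inv) _.
rewrite -[X in _ + X]mul1r -mulrDl; apply: ler_wpM2r; first by rewrite invr_ge0.
have := a_small; have := a_ge0; lra.
Qed.

Let W_BV : specnorm (W - B *m INV F A) <= 8 * nu * kap.
Proof.
apply: le_trans (acc_MM_le n2_le n1_le n1_le B_norm V_norm) _.
by apply: eq_ler; field.
Qed.

Lemma CHOL_W0_norm : specnorm W0 <= kap.
Proof.
apply: le_trans (specnorm_le_mul B0_norm A0_inv) _.
by rewrite mulfK.
Qed.

(** Three sources: rounding in the product, the distance of [B] to [B0], and the distance of the
    computed inverse to [invmx A0]; the last one, multiplied by [B0], brings in [kap]. *)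
Lemma CHOL_W_error : specnorm (W - W0) <= 16 * kap * a.
Proof.
have -> : W - W0 = (W - B *m INV F A) + (B - B0) *m INV F A
                   + B0 *m (INV F A - invmx A0).
  by rewrite mulmxBl mulmxBr !addrA !subrK.
apply: le_trans (specnorm_le_add (specnorm_le_add W_BV
  (specnorm_le_mul B_B0 V_norm)) (specnorm_le_mul B0_norm V_A0)) _.
have -> : a * alpha * (4 * alpha^-1) = 4 * a by field.
have -> : kap * alpha * (4 * a * alpha^-1) = 4 * (kap * a) by field.
have := nu_kap; have : a <= kap * a by apply: ler_peMl.
have := a_ge0; lra.
Qed.

Lemma CHOL_W_norm : specnorm W <= 2 * kap.
Proof.
apply: le_trans (specnorm_le_perturb CHOL_W_error CHOL_W0_norm) _.
have h1 : kap * (2048 * a) <= kap * 1 by apply: ler_wpM2l.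
have h2 : 0 <= kap * a by apply: mulr_ge0.
lra.
Qed.

Let X_WB : specnorm (X - W *m B^t*) <= 4 * (nu * kap) * kap * alpha.
Proof.
have Bn : specnorm (B^t*) <= 2 * (kap * alpha) by rewrite specnorm_adj.
apply: le_trans (acc_MM_le n2_le n1_le n2_le CHOL_W_norm Bn) _.
by apply: eq_ler; ring.
Qed.

Let X_error : specnorm (X - W0 *m B0^t*) <= 37 * (kap ^+ 2 * a * alpha).
Proof.
have -> : X - W0 *m B0^t* = (X - W *m B^t*) + (W - W0) *m B^t* + W0 *m (B - B0)^t*.
  by rewrite adjB mulmxBl mulmxBr !addrA !subrK.
have Bn : specnorm (B^t*) <= 2 * (kap * alpha) by rewrite specnorm_adj.
have dBn : specnorm ((B - B0)^t*) <= a * alpha by rewrite specnorm_adj.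
apply: le_trans (specnorm_le_add (specnorm_le_add X_WB
  (specnorm_le_mul CHOL_W_error Bn)) (specnorm_le_mul CHOL_W0_norm dBn)) _.
have h1 : nu * kap * (kap * alpha) <= a * (kap * alpha) by apply: ler_wpM2r.
have h2 : kap * (a * alpha) <= kap ^+ 2 * (a * alpha).
  by apply: ler_wpM2r => //; apply: mulr_ge0.
clear Bn dBn; lra.
Qed.

(** Bounding the skew part by twice [X_error] would cost [a * alpha], which [HERM] would multiply by
    [Q]. Here the distance to the exact matrix does not appear: only rounding errors and the skew
    part [t] of [A] contribute. *)
Let X_skew : specnorm (X - X^t*) <= 56 * (nu * kap) * kap * alpha + 16 * kap ^+ 2 * t.
Proof.
have [Au _] := A_unit_inv.
have Atu : A^t* \in unitmx by rewrite map_unitmx unitmx_tr.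
have Bn : specnorm (B^t*) <= 2 * (kap * alpha) by rewrite specnorm_adj.
have Atinv : specnorm (invmx (A^t*)) <= 2 * alpha^-1 by rewrite -adjV specnorm_adj.
have Vt : specnorm ((INV F A - invmx A)^t*) <= 2 * nu * alpha^-1 by rewrite specnorm_adj.
have Gt : specnorm ((W - B *m INV F A)^t*) <= 8 * nu * kap by rewrite specnorm_adj.
have XGt : specnorm ((X - W *m B^t*)^t*) <= 4 * (nu * kap) * kap * alpha by rewrite specnorm_adj.
(* The adjoint of [invmx A] is the inverse of [A^t*], so the skew part of the inverse is at most
   [4 * t * alpha^-1 ^+ 2] before rounding. *)
have Vskew : specnorm (INV F A - (INV F A)^t*) <= (4 * nu * alpha + 4 * t) * alpha^-1 ^+ 2.
  have -> : INV F A - (INV F A)^t* = (INV F A - invmx A) - (INV F A - invmx A)^t*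
      + (invmx A - invmx (A^t*)).
    rewrite adjB adjV; move: ((INV F A)^t*) (invmx (A^t*)) (INV F A) (invmx A) => x1 x2 x3 x4.
    by apply/matrixP => i j; rewrite !mxE; ring.
  apply: le_trans (specnorm_le_add (specnorm_le_sub V_inv Vt)
    (specnorm_invmxB Au Atu A_inv Atinv A_skew)) _.
  by apply: eq_ler; field.
have -> : X - X^t* = (X - W *m B^t*) - (X - W *m B^t*)^t*
    + ((W - B *m INV F A) *m B^t* - B *m (W - B *m INV F A)^t*
       + B *m (INV F A - (INV F A)^t*) *m B^t*).
  rewrite !(adjB, adjM, trmxCK, mulmxBl, mulmxBr, mulmxA).
  move: (X^t*) (W *m _) (B *m W^t*) (B *m INV F A *m _) (B *m (INV F A)^t* *m _) => x1 x2 x3 x4 x5.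
  apply/matrixP => i j; rewrite !mxE; ring.
apply: le_trans (specnorm_le_add (specnorm_le_sub X_WB XGt) (specnorm_le_add
  (specnorm_le_sub (specnorm_le_mul W_BV Bn) (specnorm_le_mul B_norm Gt))
  (specnorm_le_mul (specnorm_le_mul B_norm Vskew) Bn))) _.
by apply: eq_ler; field.
Qed.

Let QX_skew : Q * specnorm (X - X^t*) <= 72 * (kap ^+ 2 * a * alpha).
Proof.
apply: le_trans (ler_wpM2l _ X_skew) _; first exact: le_trans Q_ge1.
have h1 : Q * nu * kap * (kap * alpha) <= a * (kap * alpha) by apply: ler_wpM2r.
have h2 : kap * (a * alpha) <= kap ^+ 2 * (a * alpha).
  by apply: ler_wpM2r => //; apply: mulr_ge0.
have h3 : kap ^+ 2 * (Q * t) <= kap ^+ 2 * (a * alpha) by apply: ler_wpM2l t_le; rewrite sqr_ge0.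
lra.
Qed.

Let aalpha_ge0 : 0 <= a * alpha. Proof. exact: mulr_ge0. Qed.

Let aalpha_kap2 : a * alpha <= kap ^+ 2 * a * alpha.
Proof.
by rewrite -mulrA; apply: ler_peMl => //; apply: le_trans kap_ge1 kap_le_sqr.
Qed.

Let exact_sub_error : specnorm (D - HERM X - S0) <= 110 * (kap ^+ 2 * a * alpha).
Proof.
have -> : D - HERM X - S0 = (D - D0) - ((HERM X - X) + (X - W0 *m B0^t*)).
  rewrite /S0 /W0; move: (HERM X) (B0 *m _ *m _) => x1 x2.
  by apply/matrixP => i j; rewrite !mxE; ring.
(* The [Q] lost by [HERM] is paid by the weight already carried by the skew part. *)
have HX : specnorm (HERM X - X) <= 72 * (kap ^+ 2 * a * alpha).
  apply: le_trans (HERM_sub_le X) _; apply: le_trans QX_skew.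
  by apply: ler_wpM2r => //; exact: specnorm_ge0.
apply: le_trans (specnorm_le_sub D_D0 (specnorm_le_add HX X_error)) _.
have := aalpha_kap2; lra.
Qed.

Let D_HX_norm : specnorm (D - HERM X) <= 2 * (kap * alpha).
Proof.
have S0_norm : specnorm S0 <= kap * alpha.
  exact: hermitian_between_norm alpha_ge0 beta_ge0 (hermitian_between_schur M0_ab alpha_gt0).
apply: le_trans (specnorm_le_perturb exact_sub_error S0_norm) _.
have h1 : 2048 * (kap ^+ 2 * a) * alpha <= 1 * alpha by apply: ler_wpM2r.
have h2 : 1 * alpha <= kap * alpha by apply: ler_wpM2r.
have := aalpha_kap2; have := aalpha_ge0; lra.
Qed.

Let fl_error : specnorm (St - (D - HERM X)) <= Q * (nu * (2 * (kap * alpha))).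
Proof.
apply: le_trans (fl_subm_le D_HX_norm) _; apply: ler_wpM2r => //.
by rewrite !mulr_ge0.
Qed.

(** The constant is [1 + 72 + 37] from [D], [HERM] and [X], plus [2] from the rounded subtraction.
    It makes [112 * kap ^+ 2 * a] the new [a] for the trailing block. *)
Lemma CHOL_St_error : specnorm (St - S0) <= 112 * (kap ^+ 2 * a * alpha).
Proof.
rewrite -(subrK (D - HERM X) St) -addrA.
apply: le_trans (specnorm_le_add fl_error exact_sub_error) _.
have h1 : Q * nu * kap * alpha <= a * alpha by apply: ler_wpM2r.
have := aalpha_kap2; lra.
Qed.

(** The subtraction contributes [2 * 2] (its error and the adjoint of its error), [D] contributes
    [1], and [HERM X] contributes [72] with no further power of [n]. The bound stays below that of
    [CHOL_St_error], so one parameter can govern both errors at the next level. *)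
Lemma CHOL_St_skew : Q * specnorm (St - St^t*) <= 77 * (kap ^+ 2 * a * alpha).
Proof.
have flt : specnorm ((St - (D - HERM X))^t*) <= Q * (nu * (2 * (kap * alpha))).
  by rewrite specnorm_adj.
have -> : St - St^t* = (St - (D - HERM X)) - (St - (D - HERM X))^t*
    + ((D - D^t*) - (HERM X - (HERM X)^t*)).
  rewrite !adjB; move: (St^t*) (HERM X) ((HERM X)^t*) => x1 x2 x3.
  by apply/matrixP => i j; rewrite !mxE; ring.
apply: le_trans (ler_wpM2l Q_ge0 (specnorm_le_add (specnorm_le_sub fl_error flt)
  (specnorm_le_sub D_skew (HERM_skew_le X)))) _.
have h1 : Q ^+ 2 * nu * kap * alpha <= a * alpha by apply: ler_wpM2r.
move: (specnorm (X - X^t*)) QX_skew aalpha_kap2 t_le => s; lra.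
Qed.

Section Factors.
Context {E1 E2 : R} {L11 : 'M[C]_n1} {L22 : 'M[C]_n2}.
Hypothesis L11_error : specnorm (L11 *m L11^t* - A0) <= E1.
Hypothesis L22_error : specnorm (L22 *m L22^t* - S0) <= E2.
Hypothesis E1_le : E1 <= alpha.

Let L21 := MM F W L11.
Let l := specnorm L11.
Let G := L21 - W *m L11.

Let l_ge0 : 0 <= l. Proof. exact: specnorm_ge0. Qed.

Let l_sqr : l ^+ 2 <= 2 * (kap * alpha).
Proof.
apply: le_trans (sqr_specnorm L11) _.
apply: le_trans (specnorm_le_perturb L11_error A0_norm) _.
have : 1 * alpha <= kap * alpha by apply: ler_wpM2r.
have := E1_le; lra.
Qed.

Let G_norm : specnorm G <= 2 * nu * kap * l.
Proof.
apply: le_trans (acc_MM_le n2_le n1_le n1_le CHOL_W_norm (lexx l)) _.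
by apply: eq_ler; ring.
Qed.

Let nu_le1 : nu <= 1.
Proof. have := nu_le; have := a_small; have := a_ge0; lra. Qed.

Let L21_norm : specnorm L21 <= 4 * kap * l.
Proof.
apply: le_trans (specnorm_le_perturb G_norm (specnorm_le_mul CHOL_W_norm (lexx l))) _.
have : nu * (kap * l) <= 1 * (kap * l) by apply: ler_wpM2r => //; exact: mulr_ge0.
lra.
Qed.

Let nu_l_sqr : nu * kap * l ^+ 2 <= 2 * (kap * (a * alpha)).
Proof.
apply: le_trans (ler_pM _ _ nu_kap l_sqr) _; rewrite ?mulr_ge0 ?sqr_ge0 //.
by apply: eq_ler; ring.
Qed.

(** [L21] approximates [W *m L11], so that [L21 *m L11^t*] is close to [W *m A0], and [W0 *m A0] is
    exactly [B0]. Only the error of [L11 *m L11^t*] is involved. *)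
Lemma CHOL_L21_error :
  specnorm (L21 *m L11^t* - B0) <= 20 * (kap ^+ 2 * a * alpha) + 2 * kap * E1.
Proof.
have -> : L21 *m L11^t* - B0 = G *m L11^t* + W *m (L11 *m L11^t* - A0)
    + (W - W0) *m A0.
  rewrite /G mulmxBl mulmxBr mulmxBl mulmxA (mulmxKV A0_unit).
  by rewrite !addrA !subrK.
have L11t : specnorm (L11^t*) <= l by rewrite specnorm_adj.
apply: le_trans (specnorm_le_add (specnorm_le_add (specnorm_le_mul G_norm L11t)
  (specnorm_le_mul CHOL_W_norm L11_error)) (specnorm_le_mul CHOL_W_error A0_norm)) _.
have h1 : kap * (a * alpha) <= kap ^+ 2 * (a * alpha) by apply: ler_wpM2r.
have := nu_l_sqr; lra.
Qed.

(** The target equals [W0 *m A0 *m W0^t*], and the difference telescopes from [L21 *m L21^t*] to it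
    one factor at a time. *)
Lemma CHOL_L21_sqr_error :
  specnorm (L21 *m L21^t* - B0 *m invmx A0 *m B0^t*)
    <= 72 * (kap ^+ 3 * a * alpha) + 4 * kap ^+ 2 * E1.
Proof.
have [A0H _] := A0_ab.
have W0W0 : B0 *m invmx A0 *m B0^t* = W0 *m A0 *m W0^t*.
  by rewrite /W0 adjM adjV A0H (mulmxKV A0_unit) mulmxA.
have -> : L21 *m L21^t* - B0 *m invmx A0 *m B0^t* =
    G *m (W *m L11)^t* + L21 *m G^t* + (W *m (L11 *m L11^t* - A0) *m W^t*
    + ((W - W0) *m A0 *m W^t* + W0 *m A0 *m (W - W0)^t*)).
  rewrite W0W0 /G !(adjB, adjM, mulmxBl, mulmxBr, mulmxA).
  move: (L21 *m _) (L21 *m _ *m _) (W *m _ *m _ *m _) (W0 *m _ *m _) (W *m A0 *m _).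
  move=> x1 x2 x3 x4 x5.
  by apply/matrixP => i j; rewrite !mxE; ring.
have Wt : specnorm (W^t*) <= 2 * kap by rewrite specnorm_adj; exact: CHOL_W_norm.
have Gt : specnorm (G^t*) <= 2 * nu * kap * l by rewrite specnorm_adj.
have Wet : specnorm ((W - W0)^t*) <= 16 * kap * a by rewrite specnorm_adj; exact: CHOL_W_error.
have WLt : specnorm ((W *m L11)^t*) <= 2 * kap * l.
  by rewrite specnorm_adj; exact: specnorm_le_mul CHOL_W_norm (lexx l).
apply: le_trans (specnorm_le_add
  (specnorm_le_add (specnorm_le_mul G_norm WLt) (specnorm_le_mul L21_norm Gt))
  (specnorm_le_add (specnorm_le_mul (specnorm_le_mul CHOL_W_norm L11_error) Wt)
   (specnorm_le_add (specnorm_le_mul (specnorm_le_mul CHOL_W_error A0_norm) Wt)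
      (specnorm_le_mul (specnorm_le_mul CHOL_W0_norm A0_norm) Wet)))) _.
have h1 : kap * (nu * kap * l ^+ 2) <= kap * (2 * (kap * (a * alpha))) by apply: ler_wpM2l.
have h2 : kap ^+ 2 * (a * alpha) <= kap ^+ 3 * (a * alpha) by apply: ler_wpM2r.
clear Wt Gt Wet WLt W0W0 A0H; lra.
Qed.

(** Summing the four blocks gives [20 + 20 + 72 = 112] for the local error and [1 + 4 + 4 = 9] for
    the coefficient of [E1], with every power of [kap] raised to the largest one of its group. *)
Lemma CHOL_step_error :
  specnorm (block_mx L11 0 L21 L22 *m (block_mx L11 0 L21 L22)^t*
            - block_mx A0 (B0^t*) B0 D0)
    <= 112 * (kap ^+ 3 * a * alpha) + 9 * kap ^+ 2 * E1 + E2.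
Proof.
have -> : block_mx L11 0 L21 L22 *m (block_mx L11 0 L21 L22)^t*
            - block_mx A0 (B0^t*) B0 D0
  = block_mx (L11 *m L11^t* - A0) ((L21 *m L11^t* - B0)^t*) (L21 *m L11^t* - B0)
     ((L21 *m L21^t* - B0 *m invmx A0 *m B0^t*) + (L22 *m L22^t* - S0)).
  rewrite adj_block mulmx_block opp_block_mx add_block_mx trmx0 map_mx0.
  rewrite !mul0mx !mulmx0 !addr0 adjB adjM trmxCK; congr block_mx.
  rewrite /S0; move: (L21 *m _) (L22 *m _) (B0 *m _ *m _) => x1 x2 x3.
  by apply/matrixP => i j; rewrite !mxE; ring.
have Lt : specnorm ((L21 *m L11^t* - B0)^t*)
    <= 20 * (kap ^+ 2 * a * alpha) + 2 * kap * E1.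
  by rewrite specnorm_adj; exact: CHOL_L21_error.
apply: le_trans (specnorm_block L11_error Lt CHOL_L21_error
  (specnorm_le_add CHOL_L21_sqr_error L22_error)) _.
have E1_ge0 : 0 <= E1 := specnorm_le_ge0 L11_error.
have h1 : kap ^+ 2 * (a * alpha) <= kap ^+ 3 * (a * alpha) by apply: ler_wpM2r.
have h2 : kap * E1 <= kap ^+ 2 * E1 by apply: ler_wpM2r.
have h3 : 1 * E1 <= kap * E1 by apply: ler_wpM2r.
lra.
Qed.

End Factors.
End Step.
End BackwardError.

(** * Error of the whole recursion *)

Section CholeskyError.
Set Implicit Arguments.
Unset Strict Implicit.
Context {R : realType}.
Local Notation C := R[i].
Implicit Types (m n p : nat).

Lemma half_bounds n d : (1 < n)%N -> (n <= 2 ^ d.+1)%N ->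
  [/\ n./2 <= 2 ^ d, uphalf n <= 2 ^ d, 0 < n./2 & 0 < uphalf n]%N.
Proof. by rewrite expnS; move: (2 ^ d)%N => k n_gt1 n_k; split; lia. Qed.

Lemma modc_dist (x y : C) : `|modc x - modc y| <= modc (x - y).
Proof.
rewrite ler_norml; have := modcD (x - y) y; have := modcD (y - x) x.
rewrite !subrK -(modcN (y - x)) opprB => h1 h2; apply/andP; split; lra.
Qed.

Lemma modc_sqrtc (z : C) : modc (sqrtc z) ^+ 2 = modc z.
Proof. by rewrite expr2 -modcM -expr2 sqr_sqrtc. Qed.

Lemma mulc_conj (z : C) : z * Num.conj z = (modc z ^+ 2)%:C.
Proof. by rewrite -normCK rmorphXn /= modcE. Qed.

Context {N : nat} {F : fparith R} {nu kap alpha : R}.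
Hypothesis F_acc : fp_accurate N nu kap F.
Hypothesis nu_ge0 : 0 <= nu.
Hypothesis kap_ge1 : 1 <= kap.
Hypothesis alpha_gt0 : 0 < alpha.

Lemma hermitian_between_mx11 (M : 'M[C]_1) : hermitian_between alpha (kap * alpha) M ->
  M ord0 ord0 = (modc (M ord0 ord0))%:C /\ modc (M ord0 ord0) <= kap * alpha.
Proof.
move=> Mab; have Mn : modc (M ord0 ord0) <= kap * alpha.
  apply: le_trans (modc_le_specnorm _ _ _) _.
  apply: hermitian_between_norm (ltW alpha_gt0) _ Mab.
  exact: mulr_ge0 (le_trans ler01 kap_ge1) (ltW alpha_gt0).
split=> //; have := hermitian_between_psd (ltW alpha_gt0) Mab (const_mx 1).
rewrite dotcE big_ord1 !mxE big_ord1 !mxE /= mulr1 mul1r mul0r addr0 => Re0.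
case: Mab => /matrixP/(_ ord0 ord0); rewrite !mxE => MH _.
have /ger0_norm <- : 0 <= M ord0 ord0.
  have /(RRe_real) <- : M ord0 ord0 \is Num.real by apply/CrealP.
  by rewrite ler0c.
by rewrite modcE normr_id.
Qed.

(** The product with the adjoint has the single entry [modc (1 + d) ^+ 2] times the modulus of the
    input entry, so an imaginary part of the input does no harm: passing to moduli does not increase
    the distance to the nonnegative real entry of [M0]. *)
Lemma CHOL1_error a (M M0 : 'M[C]_1) : nu * kap <= a -> a <= 1 ->
  hermitian_between alpha (kap * alpha) M0 -> specnorm (M - M0) <= a * alpha ->
  specnorm (CHOL F M *m (CHOL F M)^t* - M0) <= 8 * a * alpha.
Proof.
move=> nua a1 M0ab MM0; have [M0E M0n] := hermitian_between_mx11 M0ab.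
have nu_a : nu <= a by apply: le_trans nua; apply: ler_peMr.
have a0 : 0 <= a by apply: le_trans nu_a.
apply: specnorm_diag => [|i j|i]; first by rewrite !mulr_ge0 // ltW.
  by rewrite !ord1 eqxx.
rewrite !ord1 CHOL_unfold /CHOL_step /= !mxE big_ord1 !mxE mulc_conj.
have [d dnu ->] := acc_sqrt F_acc (M ord0 ord0).
rewrite M0E -rmorphB modc_real modcM exprMn modc_sqrtc.
have dm : `|modc (M ord0 ord0) - modc (M0 ord0 ord0)| <= a * alpha.
  apply: le_trans (modc_dist _ _) _; apply: le_trans MM0.
  by have := modc_le_specnorm (M - M0) ord0 ord0; rewrite !mxE.
have d1 : modc (1 + d) <= 1 + nu.
  by apply: le_trans (modcD _ _) _; rewrite (modc_real 1) normr1 lerD2l.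
have d2 : 1 - nu <= modc (1 + d).
  have := modcB (1 + d) d; rewrite addrK (modc_real 1) normr1; lra.
move: (modc (1 + d)) (modc_ge0 (1 + d)) d1 d2 => r r0 r1 r2.
move: dm M0n; move: (modc (M0 ord0 ord0)) => m1.
move: (modc (M ord0 ord0)) (modc_ge0 (M ord0 ord0)) => m m0.
rewrite !ler_norml => /andP[h1 h2] h3.
have nu1 : nu <= 1 := le_trans nu_a a1.
have aal : 0 <= a * alpha by rewrite mulr_ge0 // ltW.
have m_le : m <= kap * alpha + a * alpha by lra.
(* A relative error [nu] acts on an entry as large as [kap * alpha], hence the assumption on
   [nu * kap] rather than on [nu]. *)
have num : nu * m <= 2 * (a * alpha).
  apply: le_trans (ler_wpM2l nu_ge0 m_le) _; rewrite mulrDr mulrA.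
  have : nu * kap * alpha <= a * alpha by rewrite ler_wpM2r // ltW.
  have : nu * (a * alpha) <= 1 * (a * alpha) by rewrite ler_wpM2r.
  lra.
have rr1 : r ^+ 2 <= 1 + 3 * nu by nra.
have rr2 : 1 - 3 * nu <= r ^+ 2 by nra.
have h4 : r ^+ 2 * m <= (1 + 3 * nu) * m by rewrite ler_wpM2r.
have h5 : (1 - 3 * nu) * m <= r ^+ 2 * m by rewrite ler_wpM2r.
by apply/andP; split; lra.
Qed.

Local Notation Q := (N%:R ^+ 2 : R).
Local Notation K := (256 * kap ^+ 3).

(* The skew part carries the weight [Q] because one use of [HERM] costs a factor [Q]. *)
Definition CHOL_accurate_upto (d : nat) : Prop := forall n (M M0 : 'M[C]_n) a,
  (0 < n <= N)%N -> (n <= 2 ^ d)%N ->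
  hermitian_between alpha (kap * alpha) M0 ->
  specnorm (M - M0) <= a * alpha -> Q * specnorm (M - M^t*) <= a * alpha ->
  Q ^+ 2 * nu * kap <= a -> 8 * K ^+ d * a <= 1 / 2 ->
  specnorm (CHOL F M *m (CHOL F M)^t* - M0) <= 8 * K ^+ d * a * alpha.

Let kap_ge0 : 0 <= kap. Proof. exact: le_trans kap_ge1. Qed.

Let kap3_ge1 : 1 <= kap ^+ 3. Proof. by rewrite exprn_ege1. Qed.

Let Kd_ge1 d : 1 <= K ^+ d.
Proof. by rewrite exprn_ege1 //; have := kap3_ge1; lra. Qed.

Let nu_kap_le a : (0 < N)%N -> Q ^+ 2 * nu * kap <= a -> nu * kap <= a.
Proof.
move=> N0; apply: le_trans; rewrite -mulrA; apply: ler_peMl.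
  exact: mulr_ge0.
by rewrite exprn_ege1 // exprn_ege1 // ler1n.
Qed.

Let small_le1 (a : R) : 8 * a <= 1 / 2 -> a <= 1. Proof. by lra. Qed.

(** With [P = K ^ d], the three contributions [112], [9 * 8 = 72] and [8 * 112 = 896] add up to
    [1080], below [8 * 256], once all powers of [kap] are raised to the cube. A power of two is
    chosen for the base so that [256 ^ d] becomes a power of [2 ^ d]. *)
Let step_constants d a : 0 <= a -> 8 * K ^+ d.+1 * a <= 1 / 2 ->
  [/\ 2048 * kap ^+ 3 * a <= 1, 8 * K ^+ d * a <= 1 / 2,
      8 * K ^+ d * (112 * kap ^+ 2 * a) <= 1 / 2 &
      112 * (kap ^+ 3 * a * alpha) + 9 * kap ^+ 2 * (8 * K ^+ d * a * alpha)
        + 8 * K ^+ d * (112 * kap ^+ 2 * a) * alpha <= 8 * K ^+ d.+1 * a * alpha].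
Proof.
move=> a0; rewrite exprS; move: (K ^+ d) (Kd_ge1 d) => P P_ge1 a_le.
have k2_ge0 : 0 <= kap ^+ 2 := sqr_ge0 _.
have k3_ge0 : 0 <= kap ^+ 3 := le_trans ler01 kap3_ge1.
have P_ge0 : 0 <= P := le_trans ler01 P_ge1.
have Pa0 : 0 <= P * a by rewrite mulr_ge0.
have h1 : kap ^+ 3 * a <= kap ^+ 3 * (P * a) by rewrite ler_wpM2l // ler_peMl.
have h2 : kap ^+ 2 * (P * a) <= kap ^+ 3 * (P * a).
  by rewrite ler_wpM2r // [leRHS]exprS ler_peMl.
have h3 : P * a <= kap ^+ 3 * (P * a) by rewrite ler_peMl.
have h4 : 0 <= kap ^+ 2 * (P * a) by rewrite mulr_ge0.
split; [lra|lra|lra|].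
have -> : 112 * (kap ^+ 3 * a * alpha) + 9 * kap ^+ 2 * (8 * P * a * alpha)
   + 8 * P * (112 * kap ^+ 2 * a) * alpha
   = (112 * (kap ^+ 3 * a) + 968 * (kap ^+ 2 * (P * a))) * alpha by ring.
apply: ler_wpM2r; [exact: ltW | lra].
Qed.

Lemma CHOL_block_accurate d n1 n2 (A A0 : 'M[C]_n1) Bu (B B0 : 'M[C]_(n2, n1))
    (D D0 : 'M[C]_n2) a (M := block_mx A Bu B D) (M0 := block_mx A0 (B0^t*) B0 D0) :
  CHOL_accurate_upto d -> (0 < n1)%N -> (0 < n2)%N -> (n1 + n2 <= N)%N ->
  (n1 <= 2 ^ d)%N -> (n2 <= 2 ^ d)%N ->
  hermitian_between alpha (kap * alpha) M0 ->
  specnorm (M - M0) <= a * alpha -> Q * specnorm (M - M^t*) <= a * alpha ->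
  Q ^+ 2 * nu * kap <= a -> 8 * K ^+ d.+1 * a <= 1 / 2 ->
  specnorm (CHOL_block F (CHOL F) M *m (CHOL_block F (CHOL F) M)^t* - M0)
    <= 8 * K ^+ d.+1 * a * alpha.
Proof.
move=> IH n1_gt0 n2_gt0 nN n1_d n2_d M0ab MM0 Mskew a_ge a_le.
have n1N : (0 < n1 <= N)%N by rewrite n1_gt0 (leq_trans (leq_addr _ _) nN).
have n2N : (0 < n2 <= N)%N by rewrite n2_gt0 (leq_trans (leq_addl _ _) nN).
have N_gt0 : (0 < N)%N by case/andP: n1N => /leq_trans; apply.
have Q_ge1 : 1 <= Q by rewrite exprn_ege1 // ler1n.
have n2Q : n2%:R ^+ 2 <= Q by rewrite ler_pXn2r ?nnegrE // ler_nat; case/andP: n2N.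
have nua := nu_kap_le N_gt0 a_ge.
have a0 : 0 <= a by apply: le_trans nua; rewrite mulr_ge0.
have [a_small a_le1 a_le2 a_fin] := step_constants a0 a_le.
have /specnorm_blocks[AA0 _ BB0 DD0] :
    specnorm (block_mx (A - A0) (Bu - B0^t*) (B - B0) (D - D0)) <= a * alpha.
  by rewrite -add_block_mx -opp_block_mx; exact: MM0.
(* The quotient by [Q] is the parameter [t] of the one-step analysis. *)
have Mt : specnorm (M - M^t*) <= a * alpha / Q.
  by rewrite ler_pdivlMr ?(lt_le_trans ltr01) // mulrC.
have /specnorm_blocks[At _ _ Dt] : specnorm (block_mx (A - A^t*) (Bu - B^t*)
    (B - Bu^t*) (D - D^t*)) <= a * alpha / Q.
  by rewrite -add_block_mx -opp_block_mx -adj_block; exact: Mt.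
have tQ : Q * (a * alpha / Q) <= a * alpha.
  by rewrite mulrC divfK // gt_eqF // (lt_le_trans ltr01).
have St1 := CHOL_St_error F_acc nu_ge0 kap_ge1 alpha_gt0 n1N n2N Q_ge1 n2Q a_ge a_small
  M0ab AA0 BB0 DD0 At tQ.
have St2 := CHOL_St_skew F_acc nu_ge0 kap_ge1 alpha_gt0 n1N n2N Q_ge1 n2Q a_ge a_small
  M0ab AA0 BB0 DD0 At Dt tQ.
have L11E : specnorm (CHOL F A *m (CHOL F A)^t* - A0) <= 8 * K ^+ d * a * alpha.
  apply: IH n1N n1_d (hermitian_between_ul M0ab) AA0 _ a_ge a_le1.
  by apply: le_trans tQ; apply: ler_wpM2l At; apply: le_trans Q_ge1.
(* [112 * kap ^+ 2 * a] is the parameter at which the induction hypothesis is used for the Schur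
   complement; the leading block keeps [a] itself. *)
have a'_ge : Q ^+ 2 * nu * kap <= 112 * kap ^+ 2 * a.
  apply: le_trans a_ge _; apply: ler_peMl a0 _.
  by rewrite mulr_ege1 ?ler1n // exprn_ege1.
have a'_alpha : 112 * (kap ^+ 2 * a * alpha) = 112 * kap ^+ 2 * a * alpha by rewrite !mulrA.
rewrite a'_alpha in St1.
have St2_le : 77 * (kap ^+ 2 * a * alpha) <= 112 * kap ^+ 2 * a * alpha.
  rewrite -a'_alpha; apply: ler_wpM2r; last by rewrite ler_nat.
  by rewrite !mulr_ge0 ?sqr_ge0 // ltW.
have L22E := IH _ _ _ _ n2N n2_d (hermitian_between_schur M0ab alpha_gt0) St1
  (le_trans St2 St2_le) a'_ge a_le2.
have E1_le : 8 * K ^+ d * a * alpha <= alpha.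
  apply: le_trans (ler_wpM2r (ltW alpha_gt0) a_le1) _.
  by apply: ler_piMl; [exact: ltW | rewrite ler_pdivrMr // mul1r ler1n].
have -> : CHOL_block F (CHOL F) M = block_mx (CHOL F A) 0
    (MM F (MM F B (INV F A)) (CHOL F A))
    (CHOL F (fl_subm F D (HERM (MM F (MM F B (INV F A)) (B^t*))))).
  by rewrite /CHOL_block /M block_mxKul block_mxKdl block_mxKdr.
exact: le_trans (CHOL_step_error F_acc nu_ge0 kap_ge1 alpha_gt0 n1N n2N Q_ge1 a_ge a_small
  M0ab AA0 BB0 L11E L22E E1_le) a_fin.
Qed.

Lemma hermitian_blocks n1 n2 (M : 'M[C]_(n1 + n2)) : M^t* = M ->
  M = block_mx (ulsubmx M) ((dlsubmx M)^t*) (dlsubmx M) (drsubmx M).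
Proof.
move=> MH; rewrite -[LHS]submxK; congr block_mx.
by rewrite -[in LHS]MH; apply/matrixP => i j; rewrite !mxE.
Qed.

Lemma CHOL_accurate d : CHOL_accurate_upto d.
Proof.
elim: d => [|d IH] n M M0 a nN n_d M0ab MM0 Mskew a_ge a_le.
  have /eqP n1 : n == 1%N by rewrite eqn_leq n_d; case/andP: nN.
  have N_gt0 : (0 < N)%N by case/andP: nN => /leq_trans; apply.
  subst n; rewrite expr0 mulr1 in a_le *.
  apply: CHOL1_error (nu_kap_le N_gt0 a_ge) _ M0ab MM0.
  exact: small_le1 a_le.
have N_gt0 : (0 < N)%N by case/andP: nN => /leq_trans; apply.
have a0 : 0 <= a by apply: le_trans (nu_kap_le N_gt0 a_ge); rewrite mulr_ge0.
have [n_le1|n_gt1] := leqP n 1.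
  have [_ a_le1 _ _] := step_constants a0 a_le.
  have /eqP n1 : n == 1%N by rewrite eqn_leq n_le1; case/andP: nN.
  have Pa : a <= K ^+ d.+1 * a by rewrite ler_peMl.
  subst n; apply: le_trans (CHOL1_error (nu_kap_le N_gt0 a_ge) _ M0ab MM0) _.
    by apply: small_le1; apply: le_trans a_le1; rewrite -mulrA ler_wpM2l // ler_peMl.
  by rewrite -!mulrA ler_wpM2l // mulrA; apply: ler_wpM2r Pa; apply: ltW.
rewrite CHOL_unfold /CHOL_step leqNgt n_gt1 /=.
have [half_le uphalf_le half_gt0 uphalf_gt0] := half_bounds n_gt1 n_d.
move: (half_split n) half_le uphalf_le half_gt0 uphalf_gt0.
(* With the two halves generalized, the equation for their sum can be eliminated, and the casts in
   [CHOL_step] become identities. *)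
move: (n./2) (uphalf n) => n1 n2 n12; case: n / n12 M M0 nN M0ab MM0 Mskew n_d n_gt1.
move=> M M0 /andP[_ nN] M0ab MM0 Mskew _ _ n1_d n2_d n1_gt0 n2_gt0.
rewrite !castmx_id; move: MM0 Mskew; rewrite -[M]submxK.
have [M0H _] := M0ab; move: M0ab; rewrite (hermitian_blocks M0H).
move=> M0ab MM0 Mskew.
exact: (CHOL_block_accurate IH n1_gt0 n2_gt0 nN n1_d n2_d M0ab MM0 Mskew a_ge a_le).
Qed.

End CholeskyError.

(** * From the approximate factor to the output of [TRANSH] *)

Section Transformation.
Set Implicit Arguments.
Unset Strict Implicit.
Context {R : realType}.
Local Notation C := R[i].
Implicit Types (m n p : nat).

Lemma specnorm1_ge1 n : (0 < n)%N -> 1 <= specnorm (1%:M : 'M[C]_n).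
Proof.
case: n => // n _; have := modc_le_specnorm (1%:M : 'M[C]_n.+1) ord0 ord0.
by rewrite mxE eqxx (modc_real 1) normr1.
Qed.

Lemma kappa_ge1 n (X : 'M[C]_n) : (0 < n)%N -> X \in unitmx -> 1 <= kappa X.
Proof.
move=> n_gt0 Xu; apply: le_trans (specnorm1_ge1 n_gt0) _; rewrite -(mulmxV Xu).
exact: specnorm_le_mul.
Qed.

(** Needed for [n = 1], where [log2 n] vanishes and the power of the condition number in the
    assumption on [u] is [1]. *)
Lemma kappa_mx11 (X : 'M[C]_1) : X \in unitmx -> kappa X = 1.
Proof.
move=> Xu; apply/eqP; rewrite eq_le kappa_ge1 // andbT.
have norm_le (Y : 'M[C]_1) : specnorm Y <= modc (Y ord0 ord0).
  by apply: specnorm_diag => [|i j|i]; rewrite ?modc_ge0 // !ord1 // eqxx.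
apply: le_trans (ler_pM _ _ (norm_le _) (norm_le _)) _; rewrite ?specnorm_ge0 //.
rewrite -modcM; have := mulmxV Xu => /matrixP/(_ ord0 ord0).
by rewrite !mxE big_ord1 => ->; rewrite eqxx (modc_real 1) normr1.
Qed.

(** [eigenvalue] refers to row eigenvectors, which are carried over by right multiplication with
    [invmx L] or [L]. *)
Lemma spectrum_similar n (X L : 'M[C]_n) : L \in unitmx ->
  spectrum X = spectrum (L *m X *m invmx L).
Proof.
move=> Lu; apply/seteqP; split => z /eigenvalueP[v vX v0]; apply/eigenvalueP.
  exists (v *m invmx L); first by rewrite !mulmxA mulmxKV // vX scalemxAl.
  by apply: contraNneq v0 => vL0; rewrite -(mulmxKV Lu v) vL0 mul0mx.
exists (v *m L); first by rewrite scalemxAl -vX !mulmxA mulmxKV.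
by apply: contraNneq v0 => vL0; rewrite -(mulmxK Lu v) vL0 mul0mx.
Qed.

Section PerturbedFactor.
Context {n : nat} {G H L T : 'M[C]_n} {kap alpha e c : R}.
Hypothesis kap_ge1 : 1 <= kap.
Hypothesis alpha_gt0 : 0 < alpha.
Hypothesis G_unit : G \in unitmx.
Hypothesis G_norm : specnorm G <= kap * alpha.
Hypothesis G_inv : specnorm (invmx G) <= alpha^-1.
Hypothesis L_error : specnorm (L *m L^t* - G) <= e * alpha.
Hypothesis e_half : e <= 1 / 2.

Let alpha_ge0 : 0 <= alpha. Proof. exact: ltW. Qed.
Let kap_ge0 : 0 <= kap. Proof. exact: le_trans kap_ge1. Qed.

Let LLt_inv : L *m L^t* \in unitmx /\ specnorm (invmx (L *m L^t*)) <= 2 * alpha^-1.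
Proof. by apply: (perturbed_unitmx G_unit G_inv L_error); rewrite mulfK // gt_eqF. Qed.

Lemma factor_unitmx : L \in unitmx.
Proof. by case: LLt_inv; rewrite unitmx_mul => /andP[]. Qed.

Lemma sqr_factor_norm : specnorm L ^+ 2 <= 2 * (kap * alpha).
Proof.
apply: le_trans (sqr_specnorm L) _; apply: le_trans (specnorm_le_perturb L_error G_norm) _.
have h1 : e * alpha <= 1 / 2 * alpha by apply: ler_wpM2r.
have h2 : 1 * alpha <= kap * alpha by apply: ler_wpM2r.
have h3 := alpha_ge0; lra.
Qed.

Lemma sqr_factor_inv_norm : specnorm (invmx L) ^+ 2 <= 2 * alpha^-1.
Proof.
have [LLu] := LLt_inv; apply: le_trans; rewrite -specnorm_adj.
apply: le_trans (sqr_specnorm _) _; rewrite trmxCK.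
suff -> : invmx (L *m L^t*) = (invmx L)^t* *m invmx L by exact: lexx.
apply: (can_inj (mulKmx LLu)); rewrite mulmxV // adjV mulmxA -(mulmxA L).
by rewrite mulmxV ?mulmx1 ?mulmxV ?map_unitmx ?unitmx_tr ?factor_unitmx.
Qed.

(** The argument yields the square root of [4 * kap]; since [kap] is at least [1], it is relaxed to
    [2 * kap] to stay free of roots. *)
Lemma factor_condition : specnorm L * specnorm (invmx L) <= 2 * kap.
Proof.
have := sqr_factor_norm; have := sqr_factor_inv_norm.
move: (specnorm L) (specnorm (invmx L)) (specnorm_ge0 L) (specnorm_ge0 (invmx L)).
move=> p q p_ge0 q_ge0 q2 p2.
have pq2 : (p * q) ^+ 2 <= 4 * kap.
  rewrite exprMn; apply: le_trans (ler_pM _ _ p2 q2) _; rewrite ?sqr_ge0 //.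
  by apply: eq_ler; field; rewrite gt_eqF.
have k2 : (2 * kap) ^+ 2 = 4 * (kap * kap) by ring.
have kk : kap <= kap * kap by apply: ler_peMl.
rewrite -(@ler_pXn2r _ 2) ?nnegrE ?mulr_ge0 // k2.
by apply: le_trans pq2 _; apply: ler_wpM2l.
Qed.

(** Conjugation multiplies the error of [T] by the condition number of [L], and that error already
    scales with the squared norm of [L]; together they give [2 * kap * alpha] times [2 * kap]. *)
Lemma conjugate_error : 0 <= c ->
  specnorm (T - L^t* *m H *m L) <= c * (specnorm L ^+ 2 * specnorm H) ->
  specnorm (G *m H - L *m T *m invmx L) <= (e + 4 * c * kap) * (kap * alpha) * specnorm H.
Proof.
move=> c_ge0 T_error; have Lu := factor_unitmx.
have -> : G *m H - L *m T *m invmx L =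
    - ((L *m L^t* - G) *m H + L *m (T - L^t* *m H *m L) *m invmx L).
  rewrite mulmxBr !mulmxBl !mulmxA (mulmxK Lu).
  move: (G *m H) (L *m T *m _) (L *m _ *m H) => x1 x2 x3.
  by apply/matrixP => i j; rewrite !mxE; ring.
rewrite specnormN.
apply: le_trans (specnorm_le_add (specnorm_le_mul L_error (lexx _))
  (specnorm_le_mul (specnorm_le_mul (lexx _) T_error) (lexx _))) _.
have e_ge0 : 0 <= e.
  by have := specnorm_le_ge0 L_error; rewrite pmulr_lge0.
have := sqr_factor_norm; have := factor_condition.
move: (specnorm L) (specnorm (invmx L)) (specnorm H)
  (specnorm_ge0 L) (specnorm_ge0 (invmx L)) (specnorm_ge0 H).
move=> p q h p_ge0 q_ge0 h_ge0 pq p2.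
have h1 : p ^+ 2 * (p * q) <= 2 * (kap * alpha) * (2 * kap).
  by apply: ler_pM => //; rewrite ?sqr_ge0 // mulr_ge0.
have h2 : c * h * (p ^+ 2 * (p * q)) <= c * h * (2 * (kap * alpha) * (2 * kap)).
  by apply: ler_wpM2l h1; rewrite mulr_ge0.
have h3 : e * h * (1 * alpha) <= e * h * (kap * alpha).
  by apply: ler_wpM2l; [rewrite mulr_ge0 | apply: ler_wpM2r].
have -> : e * alpha * h + p * (c * (p ^+ 2 * h)) * q
    = e * h * (1 * alpha) + c * h * (p ^+ 2 * (p * q)) by ring.
by apply: le_trans (lerD h3 h2) _; apply: eq_ler; ring.
Qed.

End PerturbedFactor.

Section Algorithm.
Context {n d : nat} {F : fparith R} {nu kap alpha Q : R} {H S : 'M[C]_n}.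
Hypothesis n_gt0 : (0 < n)%N.
Hypothesis F_acc : fp_accurate n nu kap F.
Hypothesis nu_ge0 : 0 <= nu.
Hypothesis kap_ge1 : 1 <= kap.
Hypothesis alpha_gt0 : 0 < alpha.
Hypothesis QE : Q = n%:R ^+ 2.
Local Notation K := (256 * kap ^+ 3).

Let nn : (0 < n <= n)%N. Proof. by rewrite n_gt0 leqnn. Qed.
Let alpha_ge0 : 0 <= alpha. Proof. exact: ltW. Qed.
Let kap_ge0 : 0 <= kap. Proof. exact: le_trans kap_ge1. Qed.
Let Q_ge1 : 1 <= Q. Proof. by rewrite QE exprn_ege1 // ler1n. Qed.
Let Q_ge0 : 0 <= Q. Proof. exact: le_trans Q_ge1. Qed.

Let sum3_le (s t : R) : t <= s -> s + s + t <= 3 * s. Proof. by lra. Qed.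
Let sum24_36_le (s t : R) : 0 <= s <= t -> 24 * t + 36 * s <= 200 * t.
Proof. by case/andP; lra. Qed.

(** As [X0] is Hermitian, the skew part of [X] is at most [2 * r], so [HERM] moves [X] by at most
    [2 * Q * r]. *)
Lemma HERM_error (X X0 : 'M[C]_n) r : X0^t* = X0 -> specnorm (X - X0) <= r ->
  specnorm (HERM X - X0) <= 3 * (Q * r).
Proof.
move=> X0H Xr; have r_ge0 := specnorm_le_ge0 Xr.
have HX : specnorm (HERM X - X) <= Q * (r + r).
  apply: le_trans (HERM_sub_le X) _; rewrite -QE; apply: ler_wpM2l => //.
  exact: specnorm_skew_le X0H Xr.
rewrite -(subrK X (HERM X)) -addrA.
apply: le_trans (specnorm_le_add HX Xr) _.
have rQ : 1 * r <= Q * r by apply: ler_wpM2r.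
by rewrite mulrDr; apply: sum3_le; rewrite -[leLHS]mul1r.
Qed.

Lemma congruence_error (L : 'M[C]_n) : nu <= 1 -> H^t* = H ->
  specnorm (HERM (MM F (MM F (L^t*) H) L) - L^t* *m H *m L)
    <= 9 * Q * nu * (specnorm L ^+ 2 * specnorm H).
Proof.
move=> nu_le1 HH.
have Lt : specnorm (L^t*) <= specnorm L by rewrite specnorm_adj lexx.
have Ze := acc_MM_le F_acc nu_ge0 nn nn nn Lt (lexx (specnorm H)).
have Zn : specnorm (MM F (L^t*) H) <= 2 * (specnorm L * specnorm H).
  apply: le_trans (specnorm_le_perturb Ze (specnorm_le_mul Lt (lexx _))) _.
  have := ler_wpM2r (mulr_ge0 (specnorm_ge0 L) (specnorm_ge0 H)) nu_le1.
  by rewrite mulrA mul1r mulr2n mulrDl mul1r lerD2r.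
have Ye : specnorm (MM F (MM F (L^t*) H) L - L^t* *m H *m L)
    <= 3 * nu * (specnorm L ^+ 2 * specnorm H).
  have -> : MM F (MM F (L^t*) H) L - L^t* *m H *m L = (MM F (MM F (L^t*) H) L
      - MM F (L^t*) H *m L) + (MM F (L^t*) H - L^t* *m H) *m L.
    by rewrite mulmxBl addrA subrK.
  apply: le_trans (specnorm_le_add (acc_MM_le F_acc nu_ge0 nn nn nn Zn (lexx _))
    (specnorm_le_mul Ze (lexx _))) _.
  by move: (specnorm L) (specnorm H) => p h; apply: eq_ler; ring.
have LHL : (L^t* *m H *m L)^t* = L^t* *m H *m L by rewrite !adjM trmxCK HH mulmxA.
apply: le_trans (HERM_error LHL Ye) _.
by move: (specnorm L) (specnorm H) => p h; apply: eq_ler; ring.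
Qed.

(** The recursion is started with [a = 3 * Q ^+ 2 * nu * kap], which covers the error of [HERM]
    after [INV] as well as the weighted skew part; [24] is [8 * 3]. *)
Lemma CHOL_inverse_error : (n <= 2 ^ d)%N -> S \in unitmx -> kappa S = kap ->
  hermitian_between alpha (kap * alpha) (invmx S) ->
  24 * (K ^+ d * Q ^+ 2 * nu * kap) <= 1 / 2 ->
  specnorm (CHOL F (HERM (INV F S)) *m (CHOL F (HERM (INV F S)))^t* - invmx S)
    <= 24 * (K ^+ d * Q ^+ 2 * nu * kap) * alpha.
Proof.
move=> n_le Su kapE Sab small; have [SH _] := Sab.
have beta_ge0 : 0 <= kap * alpha by apply: mulr_ge0.
have Sn := hermitian_between_norm alpha_ge0 beta_ge0 Sab.
have Ie : specnorm (INV F S - invmx S) <= nu * (kap * alpha).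
  apply: le_trans (ler_wpM2l nu_ge0 Sn); apply: (acc_INV F_acc) => //.
  by rewrite kapE ler_peMl // ler1n.
have T_ge0 : 0 <= Q * (nu * (kap * alpha)) by rewrite !mulr_ge0.
have QT : 1 * (Q * (nu * (kap * alpha))) <= Q * (Q * (nu * (kap * alpha))).
  by apply: ler_wpM2r.
have eT : 3 * (Q ^+ 2 * nu * kap) * alpha = 3 * (Q * (Q * (nu * (kap * alpha)))) by ring.
have eK : 24 * (K ^+ d * Q ^+ 2 * nu * kap) = 8 * K ^+ d * (3 * (Q ^+ 2 * nu * kap)).
  by ring.
rewrite eK in small *.
apply: (CHOL_accurate F_acc nu_ge0 kap_ge1 alpha_gt0 nn n_le Sab _ _ _ small).
- apply: le_trans (HERM_error SH Ie) _; rewrite eT; apply: ler_wpM2l => //.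
  by rewrite -{1}[Q * (nu * _)]mul1r.
- rewrite -QE eT; apply: le_trans (ler_wpM2l Q_ge0 (le_trans (HERM_skew_le _)
    (specnorm_skew_le SH Ie))) _.
  move: T_ge0 QT; rewrite mulrDr; move: (Q * (nu * (kap * alpha))) => s; lra.
- rewrite -QE; have : 0 <= Q ^+ 2 * nu * kap by rewrite !mulr_ge0 ?sqr_ge0.
  by move: (Q ^+ 2 * nu * kap) => s; lra.
Qed.

Lemma TRANSH_error eps : (n <= 2 ^ d)%N -> H^t* = H -> S \in unitmx -> kappa S = kap ->
  hermitian_between alpha (kap * alpha) (invmx S) ->
  specnorm (invmx (invmx S)) <= alpha^-1 -> eps < 1 ->
  200 * (K ^+ d * Q ^+ 2 * nu * kap) <= eps ->
  exists B : 'M[C]_n,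
    specnorm (invmx S *m H - B) <= eps * (kap * alpha) * specnorm H /\
    spectrum (TRANSH F H S) = spectrum B.
Proof.
move=> n_le HH Su kapE Sab Sinv eps_lt1 T_le.
have K_ge1 : 1 <= K ^+ d by rewrite exprn_ege1 // mulr_ege1 ?ler1n // exprn_ege1.
have QnuT : Q * nu * kap <= K ^+ d * Q ^+ 2 * nu * kap.
  apply: ler_wpM2r => //; apply: ler_wpM2r => //; rewrite expr2 mulrA.
  by apply: ler_peMl => //; rewrite mulr_ege1.
have nu_T : nu <= Q * nu * kap.
  by rewrite mulrAC; apply: ler_peMl => //; rewrite mulr_ege1.
have small : 24 * (K ^+ d * Q ^+ 2 * nu * kap) <= 1 / 2.
  by move: (K ^+ d * Q ^+ 2 * nu * kap) T_le => T; lra.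
have nu_le1 : nu <= 1.
  apply: le_trans nu_T _; apply: le_trans QnuT _.
  by move: (K ^+ d * Q ^+ 2 * nu * kap) small => T; lra.
have L_error := CHOL_inverse_error n_le Su kapE Sab small.
have beta_ge0 : 0 <= kap * alpha by apply: mulr_ge0.
have Sn := hermitian_between_norm alpha_ge0 beta_ge0 Sab.
have Siu : invmx S \in unitmx by rewrite unitmx_inv.
set L := CHOL F (HERM (INV F S)) in L_error.
exists (L *m TRANSH F H S *m invmx L); split; last first.
  exact: spectrum_similar (factor_unitmx alpha_gt0 Siu Sinv L_error small).
have c_ge0 : 0 <= 9 * Q * nu by rewrite !mulr_ge0.
apply: le_trans (conjugate_error kap_ge1 alpha_gt0 Siu Sn Sinv L_error small c_ge0
  (congruence_error L nu_le1 HH)) _.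
(* The factorization contributes [24] and the congruence [4 * 9 = 36]; the constant [200] leaves
   room. *)
apply: ler_wpM2r; first exact: specnorm_ge0.
apply: ler_wpM2r => //; apply: le_trans T_le.
have T_ge0 : 0 <= Q * nu * kap by rewrite !mulr_ge0.
have -> : 4 * (9 * Q * nu) * kap = 36 * (Q * nu * kap) by ring.
by apply: sum24_36_le; rewrite T_ge0.
Qed.

End Algorithm.

Lemma TRANSH_backward n d (F : fparith R) (nu eps : R) (H S : 'M[C]_n) :
  (0 < n <= 2 ^ d)%N -> H^t* = H -> posdefmx S -> 0 <= nu -> eps < 1 ->
  fp_accurate n nu (kappa S) F ->
  200 * ((256 * kappa S ^+ 3) ^+ d * (n%:R ^+ 2) ^+ 2 * nu * kappa S) <= eps ->
  exists B : 'M[C]_n,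
    specnorm (invmx S *m H - B) <= eps * specnorm (invmx S) * specnorm H /\
    spectrum (TRANSH F H S) = spectrum B.
Proof.
move=> /andP[n_gt0 n_le] HH Spd nu_ge0 eps_lt1 F_acc T_le.
have Su := posdefmx_unit Spd; have kap_ge1 := kappa_ge1 n_gt0 Su.
have [s_gt0 Sab] := posdefmx_between_inv n_gt0 Spd.
(* With this [alpha], the product [kap * alpha] is the norm of [invmx S], the very factor that the
   conclusion allows. *)
have alpha_gt0 : 0 < (specnorm S)^-1 by rewrite invr_gt0.
have betaE : specnorm (invmx S) = kappa S * (specnorm S)^-1.
  by rewrite /kappa mulrAC mulfV ?mul1r ?gt_eqF.
have Sinv_inv : specnorm (invmx (invmx S)) <= ((specnorm S)^-1)^-1.
  by rewrite invmxK invrK lexx.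
rewrite betaE in Sab *.
exact: (TRANSH_error n_gt0 F_acc nu_ge0 kap_ge1 alpha_gt0 erefl n_le HH Su erefl Sab
  Sinv_inv eps_lt1 T_le).
Qed.

End Transformation.

(** * Constants: from the roundoff model to one accuracy parameter *)

Section Constants.
Set Implicit Arguments.
Unset Strict Implicit.
Context {R : realType}.
Implicit Types (m n : nat).

Lemma horner_le_monomial (p : {poly R}) m n : (0 < m <= n)%N ->
  p.[m%:R] <= (\sum_(i < size p) `|p`_i|) * n%:R ^+ size p.
Proof.
case/andP=> m_gt0 m_le; rewrite horner_coef mulr_suml; apply: ler_sum => i _.
apply: le_trans (ler_norm _) _; rewrite normrM ler_wpM2l //.
rewrite ger0_norm ?exprn_ge0 //; apply: (@le_trans _ _ (n%:R ^+ i)).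
  by rewrite lerXn2r ?nnegrE ?ler_nat.
by rewrite ler_weXn2l ?ler1n ?(leq_trans m_gt0) // ltnW.
Qed.

Lemma ln2_gt0 : 0 < ln 2 :> R. Proof. by rewrite ln_gt0 // ltr1n. Qed.

Lemma log2_nat_ge0 n : 0 <= log2 (n%:R : R).
Proof.
case: n => [|n]; first by rewrite /log2 ln0 ?mul0r.
by apply: divr_ge0; [apply: ln_ge0; rewrite ler1n | exact/ltW/ln2_gt0].
Qed.

Lemma log2_nat_le m n : (0 < m <= n)%N -> log2 (m%:R : R) <= log2 n%:R.
Proof.
case/andP=> m_gt0 m_le; rewrite ler_pM2r ?invr_gt0 ?ln2_gt0 //.
by rewrite ler_ln ?posrE ?ltr0n ?ler_nat // (leq_trans m_gt0).
Qed.

Lemma powR2_log2 n : (0 < n)%N -> 2 `^ log2 (n%:R : R) = n%:R.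
Proof.
move=> n_gt0; rewrite /powR pnatr_eq0 /= divfK ?lnK ?posrE ?ltr0n //.
by rewrite gt_eqF ?ln2_gt0.
Qed.

(** Rounding up adds at most [1] to the logarithm, and [1 <= log2 n] absorbs it. *)
Lemma up_log_le_log2 n : (1 < n)%N -> (up_log 2 n)%:R <= 2 * log2 (n%:R : R).
Proof.
move=> n_gt1; have n_gt0 : (0 < n)%N by rewrite ltnW.
have l1 : 1 <= log2 (n%:R : R).
  rewrite ler_pdivlMr ?ln2_gt0 // mul1r ler_ln ?posrE ?ltr0n // ler_nat //.
have lt_n := up_log_gtn (erefl : (1 < 2)%N) n_gt1.
have : ((up_log 2 n).-1)%:R <= log2 (n%:R : R).
  rewrite ler_pdivlMr ?ln2_gt0 // mulr_natl -lnXn ?ltr0n // ler_ln ?posrE ?exprn_gt0 ?ltr0n //.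
  by rewrite -natrX ler_nat ltnW.
have d_gt0 : (0 < up_log 2 n)%N by rewrite up_log_gt0.
rewrite -[in X in _ -> X](prednK d_gt0) -natr1; lra.
Qed.

Lemma exp2_up_log n : (0 < n)%N -> (2 ^ up_log 2 n <= 2 * n)%N.
Proof.
case: n => [//|[|n] _]; first by rewrite up_log1.
have := up_log_gtn (erefl : (1 < 2)%N) (isT : (1 < n.+2)%N).
have : (0 < up_log 2 n.+2)%N by rewrite up_log_gt0.
by case: (up_log _ _) => // k _ /=; rewrite expnS leq_mul2l => /ltnW.
Qed.

(* For n = 1 the exponents are 1 and 0, hence the hypothesis on kap. *)
Lemma pow_up_log_le n (kap : R) : (0 < n)%N -> 1 <= kap -> (n = 1%N -> kap = 1) ->
  kap ^+ (3 * up_log 2 n).+1 <= kap `^ (7 * log2 (n%:R : R)).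
Proof.
move=> n_gt0 kap_ge1 kap1; have [n_le1|n_gt1] := leqP n 1.
  have n1 : n = 1%N by apply/eqP; rewrite eqn_leq n_le1.
  by rewrite (kap1 n1) powR1 expr1n.
rewrite -powR_mulrn ?(le_trans ler01) //; apply: ler_powR => //.
have l1 : 1 <= log2 (n%:R : R).
  by rewrite ler_pdivlMr ?ln2_gt0 // mul1r ler_ln ?posrE ?ltr0n // ler_nat.
have := up_log_le_log2 n_gt1; move: (up_log 2 n) => d.
have -> : (3 * d).+1%:R = 3 * d%:R + 1 :> R by rewrite -natr1 natrM.
lra.
Qed.

(** One multiple of [u] that serves all four operations: the summands cover [MM], [INV] at condition
    number up to [4 * kap], and the scalar operations. The absolute values on [c_eta] and on the
    coefficients of [p] make each term monotone in the dimension, so that [n] covers all smaller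
    blocks. *)
Definition accuracy_factor (c_eta : R) (p : {poly R}) (kap : R) n : R :=
  n%:R `^ `|c_eta|
  + (\sum_(i < size p) `|p`_i|) * n%:R ^+ size p * (4 * kap) `^ (8 * log2 n%:R) + 1.

Section Accuracy.
Context {c_eta c_INV u kap : R} {mu_INV : nat -> R} {F : fparith R}.
Context {p : {poly R}} {n : nat}.
Hypothesis F_spec : fparith_spec c_eta mu_INV c_INV u F.
Hypothesis p_mu : forall m : nat, (0 < m)%N -> mu_INV m <= p.[m%:R].
Hypothesis c_INV_le8 : c_INV <= 8.
Hypothesis u_ge0 : 0 <= u.
Hypothesis kap_ge1 : 1 <= kap.
Hypothesis n_gt0 : (0 < n)%N.

Let c := \sum_(i < size p) `|p`_i|.
Let c_ge0 : 0 <= c. Proof. by apply: sumr_ge0. Qed.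

Local Notation w := (accuracy_factor c_eta p kap n).

Let INV_term_ge0 : 0 <= c * n%:R ^+ size p * (4 * kap) `^ (8 * log2 n%:R).
Proof. by rewrite !mulr_ge0 ?exprn_ge0 ?powR_ge0. Qed.

Let le_factor1 : n%:R `^ `|c_eta| <= w.
Proof. by rewrite /accuracy_factor -addrA lerDl addr_ge0. Qed.

Let le_factor2 : c * n%:R ^+ size p * (4 * kap) `^ (8 * log2 n%:R) <= w.
Proof. by rewrite /accuracy_factor addrAC lerDr addr_ge0 ?powR_ge0. Qed.

Let le_factor3 : 1 <= w.
Proof. by rewrite /accuracy_factor lerDr addr_ge0 ?powR_ge0. Qed.

Lemma fparith_spec_accurate : fp_accurate n (w * u) kap F.
Proof.
have u_le : u <= w * u by rewrite ler_peMl.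
split.
- move=> a b; have [d [du ->]] := fl_subP F_spec a b.
  rewrite mulrDl mul1r addrAC subrr add0r modcM; apply: ler_wpM2r; first exact: modc_ge0.
  by apply: le_trans u_le; rewrite -lecR modcE.
- move=> a; have [d [du ->]] := fl_sqrtP F_spec a; exists d => //.
  by apply: le_trans u_le; rewrite -lecR modcE.
- move=> m1 m2 m3 X Y /andP[m1_gt0 m1_le] /andP[m2_gt0 m2_le] /andP[m3_gt0 m3_le].
  apply: le_trans (MMP F_spec X Y) _.
  do 3!(apply: ler_wpM2r; first by [exact: specnorm_ge0|exact: u_ge0]).
  apply: le_trans le_factor1.
  have max_ge1 : (1 <= maxn m1 (maxn m2 m3))%N by rewrite leq_max m1_gt0.
  have max_le : (maxn m1 (maxn m2 m3) <= n)%N by rewrite !geq_max m1_le m2_le m3_le.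
  apply: (@le_trans _ _ ((maxn m1 (maxn m2 m3))%:R `^ `|c_eta|)).
    by apply: ler_powR; rewrite ?ler1n ?ler_norm.
  by apply: ge0_ler_powR; rewrite ?nnegrE ?ler_nat.
- move=> m X m_n Xu kX; have /andP[m_gt0 m_le] := m_n.
  apply: le_trans (INVP F_spec m_gt0 Xu) _.
  apply: ler_wpM2r; first exact: specnorm_ge0.
  rewrite mulrAC; apply: ler_wpM2r => //; apply: le_trans le_factor2.
  have kX1 := kappa_ge1 m_gt0 Xu.
  apply: (@le_trans _ _ (c * n%:R ^+ size p * kappa X `^ (c_INV * log2 m%:R))).
    apply: ler_wpM2r; first exact: powR_ge0.
    exact: le_trans (p_mu m_gt0) (horner_le_monomial p m_n).
  apply: ler_wpM2l; first by rewrite mulr_ge0 ?exprn_ge0.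
  apply: (@le_trans _ _ (kappa X `^ (8 * log2 n%:R))).
    apply: ler_powR => //; apply: (@le_trans _ _ (8 * log2 m%:R)).
      by rewrite ler_wpM2r ?log2_nat_ge0.
    by rewrite ler_wpM2l // log2_nat_le.
  apply: ge0_ler_powR => //; first by rewrite mulr_ge0 ?log2_nat_ge0.
    by rewrite nnegrE (le_trans ler01).
  by rewrite nnegrE mulr_ge0 // (le_trans ler01).
Qed.

Lemma accuracy_factor_ge0 : 0 <= w.
Proof. exact: le_trans ler01 le_factor3. Qed.

(** The [4] in [4 * kap] costs only a polynomial, since [4 ^ (8 * log2 n) = n ^ 16]. In [2 + c], the
    [2] stands for the first and last summands of the factor. *)
Lemma accuracy_factor_le : w <=
  (2 + c) * n%:R `^ (`|c_eta| + (size p)%:R + 16) * kap `^ (8 * log2 n%:R).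
Proof.
have n_ge1 : 1 <= n%:R :> R by rewrite ler1n.
have n_neq0 : n%:R != 0 :> R by rewrite pnatr_eq0 -lt0n.
have kap_ge0 : 0 <= kap by apply: le_trans kap_ge1.
have powR_ge1 (x r : R) : 1 <= x -> 0 <= r -> 1 <= x `^ r.
  by move=> x1 r0; rewrite -(powRr0 x); apply: ler_powR.
have four : (4 : R) `^ (8 * log2 n%:R) = n%:R ^+ 16.
  rewrite (_ : 4 = 2 `^ 2%:R :> R); last by rewrite powR_mulrn // -natrX.
  rewrite -powRrM mulrA mulrC powRrM powR2_log2 // -natrM powR_mulrn //.
rewrite /accuracy_factor -/c powRM // four.
rewrite [_ `^ (_ + _ + _)]powRD; last by rewrite n_neq0 implybT.
rewrite [_ `^ (`|c_eta| + _)]powRD; last by rewrite n_neq0 implybT.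
rewrite (powR_mulrn _ (ler0n _ _)) (powR_mulrn 16 (ler0n _ _)).
have := powR_ge1 _ _ n_ge1 (normr_ge0 c_eta).
have : 1 <= kap `^ (8 * log2 n%:R).
  by apply: powR_ge1 => //; rewrite mulr_ge0 ?log2_nat_ge0.
have : 1 <= n%:R ^+ size p :> R by rewrite exprn_ege1.
have : 1 <= n%:R ^+ 16 :> R by rewrite exprn_ege1.
move: (n%:R `^ _) (n%:R ^+ _) (kap `^ _) (n%:R ^+ _) => x1 x2 x3 x4.
move=> h4 h2 h3 h1.
have ge0 (x : R) : 1 <= x -> 0 <= x := le_trans ler01.
have all_ge1 : 1 <= x1 * x2 * x4 * x3 by rewrite !mulr_ege1.
have x1_le : x1 <= x1 * x2 * x4 * x3.
  by rewrite -!mulrA ler_peMr ?ge0 // !mulr_ege1.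
have x_le : c * (x2 * (x4 * x3)) <= c * (x1 * (x2 * (x4 * x3))).
  by rewrite ler_wpM2l // ler_peMl // !mulr_ge0 // ge0.
lra.
Qed.

End Accuracy.

(** The exponent [28] is [16 + 8 + 4]: from the accuracy factor, from [256 ^+ d], and from [Q ^+ 2].
    The exponent [15] is [7 + 8]: from the levels of the recursion and from [INV]. *)
Lemma roundoff_requirement (c a : R) (kap w : R) k n : (0 < n)%N -> 0 <= c ->
  1 <= kap -> (n = 1%N -> kap = 1) -> 0 <= w ->
  w <= (2 + c) * n%:R `^ (a + k%:R + 16) * kap `^ (8 * log2 n%:R) ->
  200 * ((256 * kap ^+ 3) ^+ up_log 2 n * (n%:R ^+ 2) ^+ 2 * w * kap)
    <= 200 * 256 * (2 + c) * n%:R `^ (a + k%:R + 28) * kap `^ (15 * log2 n%:R).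
Proof.
move=> n_gt0 c_ge0 kap_ge1 kap1 w_ge0 w_le.
have n_neq0 : n%:R != 0 :> R by rewrite pnatr_eq0 -lt0n.
have kap_ge0 : 0 <= kap by apply: le_trans kap_ge1.
have kap_neq0 : kap != 0 by rewrite gt_eqF // (lt_le_trans ltr01).
set d := up_log 2 n.
(* As [256 = 2 ^ 8], this power is [(2 ^ d) ^ 8], and [2 ^ d] is at most [2 * n]. *)
have p256 : (256 : R) ^+ d <= 256 * n%:R ^+ 8.
  rewrite (_ : 256 = 2 ^+ 8 :> R); last by rewrite -natrX.
  rewrite -exprM mulnC exprM -exprMn ler_pXn2r ?nnegrE ?exprn_ge0 ?mulr_ge0 //.
  by rewrite -natrX -natrM ler_nat exp2_up_log.
have -> : 200 * ((256 * kap ^+ 3) ^+ d * (n%:R ^+ 2) ^+ 2 * w * kap)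
    = 200 * (256 ^+ d * n%:R ^+ 4) * (kap ^+ (3 * d).+1 * w).
  rewrite exprMn -!exprM [kap ^+ (3 * d).+1]exprS.
  by move: (256 ^+ d) (kap ^+ (3 * d)) => x y; ring.
have -> : 200 * 256 * (2 + c) * n%:R `^ (a + k%:R + 28) * kap `^ (15 * log2 n%:R)
    = 200 * (256 * n%:R ^+ 8 * n%:R ^+ 4) * (kap `^ (7 * log2 n%:R) *
      ((2 + c) * n%:R `^ (a + k%:R + 16) * kap `^ (8 * log2 n%:R))).
  rewrite (_ : a + k%:R + 28 = (a + k%:R + 16) + 12%:R); last by ring.
  rewrite [n%:R `^ (_ + 12%:R)]powRD ?n_neq0 ?implybT // powR_mulrn //.
  rewrite (_ : 15 * log2 n%:R = 7 * log2 n%:R + 8 * log2 n%:R); last by ring.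
  by rewrite [kap `^ (_ + _)]powRD ?kap_neq0 ?implybT //; ring.
apply: ler_pM; rewrite ?mulr_ge0 ?exprn_ge0 //.
  by rewrite ler_wpM2l // ler_wpM2r ?exprn_ge0.
by apply: ler_pM => //; rewrite ?exprn_ge0 // pow_up_log_le.
Qed.

End Constants.

Theorem theorem7p1 (R : realType) (c_eta : R) (mu_INV : nat -> R) (c_INV : R)
    (mu_INV_poly : poly_bounded mu_INV) (c_INV_le8 : c_INV <= 8) :
  exists rho1 rho2 rho3 : R,
    [/\ 0 < rho1, 0 < rho2 & 0 < rho3] /\
    forall (n : nat) (H S : 'M[R[i]]_n) (eps u : R) (F : fparith R),
      (0 < n)%N ->
      H \is hermsymmx ->
      posdefmx S ->
      specnorm H <= 1 ->
      specnorm (invmx S) <= 1 ->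
      specnorm (invmx S *m H) <= 1 ->
      0 < eps < 1 ->
      0 <= u ->
      fparith_spec c_eta mu_INV c_INV u F ->
      u <= eps * (1 / (rho1 * n%:R `^ rho2
                       * kappa S `^ (rho3 * log2 (n%:R : R)))) ->
      exists B : 'M[R[i]]_n,
        specnorm (invmx S *m H - B) <= eps * specnorm (invmx S) * specnorm H /\
        spectrum (TRANSH F H S) = spectrum B.
Proof.
case: mu_INV_poly => p p_mu; pose c := \sum_(i < size p) `|p`_i|.
have c_ge0 : 0 <= c by apply: sumr_ge0.
exists (200 * 256 * (2 + c)), (`|c_eta| + (size p)%:R + 28), 15; split.
  split; [by rewrite mulr_gt0 // ltr_wpDr | | by rewrite ltr0n].
  by apply: ltr_wpDl; rewrite ?addr_ge0 ?ltr0n.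
move=> n H S eps u F n_gt0 HH Spd _ _ _ /andP[eps_gt0 eps_lt1] u_ge0 F_spec u_le.
have Su := posdefmx_unit Spd; have kap_ge1 := kappa_ge1 n_gt0 Su.
have kap1 : n = 1%N -> kappa S = 1.
  by move=> n1; subst n; exact: kappa_mx11.
have F_acc := fparith_spec_accurate F_spec p_mu c_INV_le8 u_ge0 kap_ge1 (n := n).
have w_le := accuracy_factor_le (c_eta := c_eta) (p := p) kap_ge1 n_gt0.
have w_ge0 := accuracy_factor_ge0 (c_eta := c_eta) (p := p) (kap := kappa S) (n := n).
have req := roundoff_requirement n_gt0 c_ge0 kap_ge1 kap1 w_ge0 w_le.
apply: (TRANSH_backward (d := up_log 2 n) _ (hermsymmxP HH) Spd _ eps_lt1 F_acc).
- by rewrite n_gt0 up_logP.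
- exact: mulr_ge0.
set rho := 200 * 256 * _ * _ * _ in req u_le.
have rho_gt0 : 0 < rho.
  have kap_gt0 : 0 < kappa S by apply: lt_le_trans ltr01 kap_ge1.
  have c2_gt0 : 0 < 2 + c by rewrite ltr_wpDr.
  by apply: mulr_gt0; [apply: mulr_gt0; [exact: mulr_gt0 |] |]; rewrite powR_gt0 ?ltr0n.
have {}u_le : u * rho <= eps by rewrite -ler_pdivlMr // -[_^-1]div1r.
apply: le_trans u_le.
rewrite [u * _]mulrC; apply: le_trans (ler_wpM2r u_ge0 req); apply: eq_ler; ring.
Qed.
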